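(* Let $d\ge 2$, $\lambda>0$, let $\mu_1$ be the Cauchy distribution $d\mu_1(x)=\frac{\lambda}{\pi(x^2+\lambda^2)}dx$, let $\mu_2$ be any probability measure on $\mathbb{R}$, and let $H^\omega$ be the Anderson model on $\ell^2(\mathbb{Z}^d)$ with single site distribution $\mu=\mu_1*\mu_2$ and density of states function $\rho$. Let $E\in\mathbb{R}$ with $\rho(E)>0$, let $0<\gamma<\frac{d-1}{2d}$ and $-\infty<a<b<\infty$. Then for a.e. $\omega$, $$\lim_{L\to\infty}\frac{\#\big\{j:E_j\in I_{a,b,L},\ E_j\in\sigma(H^\omega_L)\big\}}{(b-a)(2L+1)^{d-\gamma}}=\rho(E),$$ where $I_{a,b,L}=\Big[E+\frac{a}{(2L+1)^\gamma},\,E+\frac{b}{(2L+1)^\gamma}\Big]$.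
   Context: Anderson model with single site distribution (SSD) $\mu$: the random self-adjoint operator $H^\omega=\Delta+V^\omega$ on $\ell^2(\mathbb{Z}^d)$, where $(\Delta u)(n)=\sum_{|k-n|=1}u(k)$ and $(V^\omega u)(n)=\omega_n u(n)$, with $\{\omega_n\}_{n\in\mathbb{Z}^d}$ i.i.d. real random variables of law $\mu$. Let $\Lambda_L=\{n\in\mathbb{Z}^d:|n_i|\le L,\ 1\le i\le d\}$, $\chi_L$ the orthogonal projection onto $\ell^2(\Lambda_L)$, and $H^\omega_L=\chi_LH^\omega\chi_L$, a symmetric matrix of order $(2L+1)^d$, whose eigenvalues are counted with multiplicity. Density of states: $\mathcal{N}(E)=\lim_{L\to\infty}(2L+1)^{-d}\#\{j:E_j\le E,\ E_j\in\sigma(H^\omega_L)\}$ (nonrandom limit, a.e. $\omega$) is the integrated density of states, and the density of states measure $\nu$ is defined by $\nu(-\infty,E]=\mathcal{N}(E)$ (equivalently $\nu(B)=\mathbb{E}\langle e_0,E_{H^\omega}(B)e_0\rangle$, with $E_{H^\omega}$ the spectral measure and $\{e_n\}$ the standard basis). For SSD $\mu_1*\mu_2$ the measure $\nu$ is absolutely continuous; its density $\rho$, the density of states function, has a continuous (indeed $C^\infty$) version, and $\rho(E)$ refers to that version. *)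

(* Defs.v *)
From HB Require Import structures.
From mathcomp Require Import all_boot all_order all_algebra.
From mathcomp Require Import all_classical all_reals all_analysis.
From mathcomp Require polyrcf.

Set Implicit Arguments.
Unset Strict Implicit.
Unset Printing Implicit Defensive.

Import Order.TTheory GRing.Theory Num.Theory.
Import numFieldNormedType.Exports.

Local Open Scope classical_set_scope.
Local Open Scope ring_scope.

Notation site d := {ffun 'I_d -> int}.

(* Two sites are neighbours when they are at Euclidean distance 1, that is, at
   l^1 distance 1 since the coordinates are integers. *)
Definition dist1 (d : nat) (m n : site d) : nat :=
  (\sum_(i < d) absz ((m - n)%R i))%N.

Definition laplacian (R : realType) (d : nat) (u : site d -> R) : site d -> R :=
  fun n => \sum_(k \in [set k | dist1 k n = 1%N]) u k.

Definition anderson (R : realType) (d : nat) (v u : site d -> R) : site d -> R :=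
  fun n => laplacian u n + v n * u n.

Definition std_basis (R : realType) (d : nat) (n : site d) : site d -> R :=
  fun m => (m == n)%:R.

(* box_site enumerates Lambda_L = {n | |n_i| <= L for all i}: see
   box_site_inj and box_siteP. *)
Notation box d L := {ffun 'I_d -> 'I_(L.*2.+1)}.

Definition box_site (d L : nat) (x : box d L) : site d :=
  [ffun i => (x i)%:Z - L%:Z].

Lemma box_site_inj (d L : nat) : injective (@box_site d L).
Proof.
move=> x y /ffunP xy; apply/ffunP => i; apply/val_inj.
by have := xy i; rewrite !ffunE => /addIr[].
Qed.

Lemma box_siteP (d L : nat) (n : site d) :
  (exists x : box d L, box_site x = n) <-> forall i, `|n i| <= L%:Z.
Proof.
split=> [[x <-] i|nL].
  rewrite ffunE ler_norml lerBlDr lerBrDl subrr lez_nat leq0n /= -PoszD.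
  by rewrite lez_nat addnn -ltnS ltn_ord.
have h i : 0 <= n i + L%:Z <= (L.*2)%:Z.
  have := nL i; rewrite ler_norml => /andP[h1 h2].
  by rewrite -lerBlDr sub0r h1 /= -addnn PoszD lerD2r.
exists [ffun i => inord (absz (n i + L%:Z))]; apply/ffunP => i; rewrite !ffunE.
have /andP[h1 h2] := h i.
by rewrite inordK ?gez0_abs ?addrK // ltnS -lez_nat gez0_abs.
Qed.

Lemma card_box (d L : nat) : #|{: box d L}| = ((L.*2.+1) ^ d)%N.
Proof. by rewrite card_ffun !card_ord. Qed.

(* The matrix of chi_L H chi_L in the basis (e_n) with n in Lambda_L. *)
Definition anderson_box (R : realType) (d : nat) (v : site d -> R) (L : nat) :
    'M[R]_(#|{: box d L}|) :=
  \matrix_(i, j) anderson v (std_basis R (box_site (enum_val j)))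
                            (box_site (enum_val i)).

(* The real eigenvalues, repeated according to their algebraic multiplicity;
   polyrcf.rootsR p lists the distinct real roots of p <> 0. *)
Definition eigenvalues (R : realType) (N : nat) (A : 'M[R]_N) : seq R :=
  flatten [seq nseq (mup x (char_poly A)) x
          | x <- polyrcf.rootsR (char_poly A)].

Definition eig_count (R : realType) (d : nat) (v : site d -> R) (L : nat)
    (I : interval R) : nat :=
  count (fun x => x \in I) (eigenvalues (anderson_box v L)).

Section Probability.
Context {R : realType} {disp : measure_display} {Omega : measurableType disp}.

Definition cauchy_pdf (lam x : R) : R := lam / (pi * (x ^+ 2 + lam ^+ 2)).

Definition is_cauchy (lam : R) (mu : probability (measurableTypeR R) R) :=
  forall B, measurable B ->
    mu B = (\int[lebesgue_measure]_(x in B) (cauchy_pdf lam x)%:E)%E.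

Definition convolution (mu1 mu2 : probability (measurableTypeR R) R) :
    set (measurableTypeR R) -> \bar R :=
  pushforward (mu1 \x mu2)%E (fun x => x.1 + x.2).

Definition mutually_independent (P : probability Omega R) (T : choiceType)
    (X : T -> {RV P >-> measurableTypeR R}) :=
  forall (s : seq T) (B : T -> set (measurableTypeR R)),
    uniq s -> (forall n, measurable (B n)) ->
    P (\bigcap_(n in [set` s]) (X n @^-1` B n)) =
    (\prod_(n <- s) P (X n @^-1` B n))%E.

Definition iid_with_law (P : probability Omega R) (T : choiceType)
    (X : T -> {RV P >-> measurableTypeR R})
    (mu : set (measurableTypeR R) -> \bar R) :=
  mutually_independent X /\
  forall n B, measurable B -> distribution P (X n) B = mu B.

Context (P : probability Omega R) (d : nat).
Variable omega : site d -> {RV P >-> measurableTypeR R}.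

Definition potential (w : Omega) : site d -> R := fun n => omega n w.

Definition is_ids (N : R -> R) :=
  forall x : R, {ae P, forall w,
    (eig_count (potential w) L `]-oo, x])%:R / (L.*2.+1)%:R ^+ d
      @[L --> \oo] --> N x}.

Definition is_dos_measure (nu : {measure set (measurableTypeR R) -> \bar R}) :=
  exists2 N : R -> R, is_ids N & forall x, nu [set y | y <= x] = (N x)%:E.

(* rho is the continuous version of the density of nu. *)
Definition is_dos_function (rho : R -> R) :=
  exists2 nu : {measure set (measurableTypeR R) -> \bar R},
    is_dos_measure nu &
    [/\ continuous rho, forall x, 0 <= rho x &
        forall B, measurable B ->
          nu B = (\int[lebesgue_measure]_(x in B) (rho x)%:E)%E].

End Probability.

(* Main.v *)
From HB Require Import structures.
Require Import Defs.
From mathcomp Require Import all_boot all_order all_algebra.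
From mathcomp Require Import all_classical all_reals all_analysis.
From mathcomp Require Import measurable_realfun.
From mathcomp Require polyrcf.
From mathcomp Require Import complex spectral sesquilinear zify ring lra.
Import Order.TTheory GRing.Theory Num.Theory.
Import numFieldNormedType.Exports.
Local Open Scope classical_set_scope.
Local Open Scope ring_scope.
Set Implicit Arguments.
Unset Strict Implicit.

(** Changing the potential at one site perturbs H_L by a matrix of rank one, so
    it changes the number F_L(x) of eigenvalues below x by at most 1, and the
    Efron-Stein inequality gives Var F_L(x) <= (2L+1)^d.  Cutting a large box
    into translates of Lambda_L changes the count by at most a constant times
    the surface of the blocks, so stationarity gives
    |E F_L(x) - (2L+1)^d N(x)| <= 2 d (2L+1)^(d-1).  As d - 2 gamma >= 3/2, the
    normalised variances are summable, hence almost surely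
    F_L(x_L) = (2L+1)^d N(x_L) + o((2L+1)^(d-gamma)) along any deterministic
    sequence x_L, and the increment of N over I_{a,b,L} is governed by the
    continuity of rho at E. *)

(** * Eigenvalue counts of symmetric matrices *)

Section Spectrum.
Local Open Scope sesquilinear_scope.
Context {R : realType}.
Local Notation "x %:C" := (real_complex R x).

(** A variance of the order of the volume, divided by the square of (2L+1)^(d-gamma), leaves
    (2L+1)^-(d-2 gamma); an exponent above 1 makes the sum over all L finite, so no subsequence of
    boxes has to be extracted. The surface error of the mean is harmless because, normalised, it is
    of order (2L+1)^-(1-gamma). The rate for the mean comes from freezing L and letting the number
    of blocks grow: after division by that number the cutting error no longer depends on it, while
    the mean count per site of the large box tends to N(x). Two obstacles shape the rest. The count
    is defined through roots of a characteristic polynomial, so its measurability has to be derived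
    from its monotonicity in the diagonal entries. And the window is closed on the left, whereas a
    difference of counting functions misses an eigenvalue equal to the left endpoint; a second
    endpoint, lower by 1/(2L+1), provides the upper bound, and this shift is negligible against the
    window length (b-a)/(2L+1)^gamma because gamma < 1. *)

Lemma conj_real_complex (x : R) : (x%:C)^* = x%:C.
Proof. by apply/CrealP/complex_realP; exists x. Qed.

Lemma mup_prod_XsubC (s : seq R) a : mup a (\prod_(x <- s) ('X - x%:P)) = count_mem a s.
Proof.
elim: s => [|y s IH]; first by rewrite big_nil mupNroot // root1.
rewrite big_cons mupM ?polyXsubC_eq0 ?monic_neq0 ?monic_prod_XsubC // IH.
by rewrite -[X in mup a X]expr1 mup_XsubCX /=; case: eqP.
Qed.

Lemma perm_eigenvalues n (A : 'M[R]_n) (s : seq R) :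
  char_poly A = \prod_(x <- s) ('X - x%:P) -> perm_eq (eigenvalues A) s.
Proof.
move=> As; rewrite /eigenvalues As; set p := \prod_(x <- s) _.
have p0 : p != 0 by rewrite monic_neq0 ?monic_prod_XsubC.
apply/allP => a _ /=; apply/eqP; rewrite count_flatten -map_comp sumnE big_map.
have -> : \sum_(x <- polyrcf.rootsR p) (count_mem a \o (fun x => nseq (mup x p) x)) x
   = (\sum_(x <- polyrcf.rootsR p | x == a) mup x p)%N.
  rewrite [RHS]big_mkcond; apply: eq_bigr => x _ /=.
  by rewrite count_nseq /=; case: eqP; rewrite ?mul1n ?mul0n.
rewrite -mup_prod_XsubC -/p.
have [ap|/negbTE ap] := boolP (a \in polyrcf.rootsR p).
  by rewrite -big_filter filter_pred1_uniq ?big_seq1 // polyrcf.uniq_roots.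
rewrite big1_seq; first last.
  by move=> x /andP[/eqP ->]; rewrite ap.
by rewrite mupNroot //; have := polyrcf.roots_on_rootsR p0 a; rewrite ap in_itv /= => ->.
Qed.

Definition fun_mx (T : finType) (f : T -> T -> R) : 'M[R]_#|T| :=
  \matrix_(i, j) f (enum_val i) (enum_val j).

Definition cnt (T : finType) (f : T -> T -> R) (x : R) : nat :=
  count (fun y => y <= x) (eigenvalues (fun_mx f)).

Lemma eq_cnt (T : finType) (f g : T -> T -> R) x :
  (forall s t, f s t = g s t) -> cnt f x = cnt g x.
Proof.
by move=> fg; have -> : f = g by apply/funext => s; apply/funext => t.
Qed.

(* [e a] is the eigenvector for the eigenvalue [lam a]; orthonormality is
   stated as completeness. *)
Definition eigenbasis (T : finType) (f : T -> T -> R) (lam : T -> R)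
    (e : T -> T -> R[i]) :=
  (forall s t, \sum_a e a s * (e a t)^* = (s == t)%:R) /\
  (forall a s, \sum_t (f s t)%:C * e a t = (lam a)%:C * e a s).

Lemma sum_enum_val (T : finType) (V : nmodType) (F : T -> V) :
  \sum_(i < #|T|) F (enum_val i) = \sum_t F t.
Proof. by rewrite -(big_enum_val (A := mem T) F). Qed.

(** The complexified matrix is Hermitian because [f] is real and symmetric. This makes the diagonal
    of its spectral decomposition real, so that only the eigenvectors remain complex; they are the
    conjugated rows of the unitary matrix. *)
Lemma eigenbasis_exists (T : finType) (f : T -> T -> R) :
  (forall s t, f s t = f t s) -> exists lam e, eigenbasis f lam e.
Proof.
move=> fC; pose A : 'M[R[i]]_#|T| := map_mx (real_complex R) (fun_mx f).
have Ah : A \is hermsymmx.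
  apply: realsym_hermsym.
    by apply/is_hermitianmxP; rewrite expr0 scale1r; apply/matrixP => i j; rewrite !mxE fC.
  by apply/mxOverP => i j; rewrite !mxE; apply/complex_realP; eexists.
have /mxOverP Dr := hermitian_spectral_diag_real Ah.
have := Ah => /hermitian_normalmx/orthomx_spectralP.
have := spectral_unitarymx A; move: Dr.
move: (spectralmx A) (spectral_diag A) => P D Dr Pu.
have Pc : (P ^t Num.conj) *m P = 1%:M.
  by rewrite -invmx_unitary // mulVmx // unitarymx_unit.
rewrite invmx_unitary // => AE.
exists (fun a => complex.Re (D ord0 (enum_rank a))),
  (fun a s => (P (enum_rank a) (enum_rank s))^*); split=> [s t|a s].
  under eq_bigr do rewrite conjCK.
  have /matrixP/(_ (enum_rank s) (enum_rank t)) := Pc.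
  rewrite !mxE (inj_eq enum_rank_inj) => <-.
  rewrite -[LHS]sum_enum_val; apply: eq_bigr => i _.
  by rewrite enum_valK !mxE.
have AP : A *m (P ^t Num.conj) = (P ^t Num.conj) *m diag_mx D.
  rewrite AE -!mulmxA; congr (_ *m _).
  suff -> : P *m (P ^t Num.conj) = 1%:M by rewrite mulmx1.
  exact/mulmx1C.
rewrite RRe_real //.
have /matrixP/(_ (enum_rank s) (enum_rank a)) := AP.
rewrite mul_mx_diag !mxE mulrC => <-.
rewrite -[LHS]sum_enum_val; apply: eq_bigr => i _.
by rewrite !mxE !enum_rankK enum_valK.
Qed.

(** Bridge from roots of the characteristic polynomial to a diagonalising family: unitary similarity
    splits the polynomial into the factors X - [lam t], and algebraic multiplicity becomes the
    number of indices. *)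
Lemma cnt_eigenbasis (T : finType) (f : T -> T -> R) lam e x :
  eigenbasis f lam e -> cnt f x = #|[set t | lam t <= x]%SET|.
Proof.
move=> [eO eE]; pose A := map_mx (real_complex R) (fun_mx f).
pose E : 'M[R[i]]_#|T| := \matrix_(i, j) e (enum_val j) (enum_val i).
pose D : 'rV[R[i]]_#|T| := \row_j (lam (enum_val j))%:C.
have EE : E *m (E ^t Num.conj) = 1%:M.
  apply/matrixP => i j; rewrite !mxE.
  have := eO (enum_val i) (enum_val j); rewrite (inj_eq enum_val_inj) => <-.
  rewrite -[RHS]sum_enum_val; apply: eq_bigr => k _.
  by rewrite !mxE.
have AE : A *m E = E *m diag_mx D.
  apply/matrixP => i j; rewrite mul_mx_diag !mxE mulrC -eE -[RHS]sum_enum_val.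
  by apply: eq_bigr => k _; rewrite !mxE.
pose s := [seq lam (enum_val i) | i <- enum 'I_#|T|].
have char : char_poly (fun_mx f) = \prod_(y <- s) ('X - y%:P).
  apply: (map_poly_inj (real_complex R)); rewrite map_char_poly -/A.
  rewrite /char_poly.
  (* Lifted to constant polynomial matrices, the unitary matrix and its adjoint act on X - A itself,
     and determinants can be compared. *)
  pose F := map_mx polyC E; pose G := map_mx polyC (E ^t Num.conj).
  have FG : F *m G = 1%:M by rewrite -map_mxM EE map_mx1.
  have -> : char_poly_mx A = F *m char_poly_mx (diag_mx D) *m G.
    rewrite /char_poly_mx mulmxBr mulmxBl -map_mxM -AE.
    rewrite scalar_mxC -mulmxA FG mulmx1; congr (_ - _).
    by rewrite -map_mxM -mulmxA EE mulmx1.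
  rewrite !det_mulmx mulrAC -det_mulmx FG det1 mul1r.
  rewrite -/(char_poly _) char_poly_trig ?diag_mx_is_trig //.
  rewrite rmorph_prod /= big_map big_enum /=; apply: eq_bigr => i _.
  by rewrite map_polyXsubC !mxE eqxx mulr1n.
rewrite /cnt (seq.permP (perm_eigenvalues char)) count_map -sum1_count big_enum_cond /=.
rewrite -[RHS]sum1_card big_mkcond /= [RHS]big_mkcond /= -[RHS]sum_enum_val.
by apply: eq_bigr => i _; rewrite inE.
Qed.

Definition coef (T : finType) (e : T -> T -> R[i]) (u : T -> R[i]) (a : T) :=
  \sum_s (e a s)^* * u s.

Definition quad (T : finType) (f : T -> T -> R) (u : T -> R[i]) :=
  \sum_s (u s)^* * \sum_t (f s t)%:C * u t.

Lemma parseval (T : finType) (f : T -> T -> R) lam e (u v : T -> R[i]) :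
  eigenbasis f lam e ->
  \sum_a (coef e u a)^* * coef e v a = \sum_s (u s)^* * v s.
Proof.
move=> [eO _]; rewrite /coef.
transitivity (\sum_a \sum_s \sum_t (u s)^* * v t * (e a s * (e a t)^*)).
  apply: eq_bigr => a _; rewrite rmorph_sum mulr_suml; apply: eq_bigr => s _.
  rewrite mulr_sumr; apply: eq_bigr => t _; rewrite rmorphM /= conjCK.
  by rewrite mulrC mulrACA mulrC; congr (_ * _); rewrite mulrC.
rewrite exchange_big; apply: eq_bigr => s _; rewrite exchange_big /=.
under eq_bigr do rewrite -mulr_sumr eO.
rewrite (bigD1 s) //= eqxx mulr1 big1 ?addr0 // => t /negbTE.
by rewrite eq_sym => ->; rewrite mulr0.
Qed.

Lemma coef_mul (T : finType) (f : T -> T -> R) lam e (u : T -> R[i]) a :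
  (forall s t, f s t = f t s) -> eigenbasis f lam e ->
  coef e (fun s => \sum_t (f s t)%:C * u t) a = (lam a)%:C * coef e u a.
Proof.
move=> fC [_ eE]; rewrite /coef.
under eq_bigr do rewrite mulr_sumr.
rewrite exchange_big mulr_sumr; apply: eq_bigr => t _.
rewrite mulrA -[(lam a)%:C]conj_real_complex -rmorphM -eE rmorph_sum mulr_suml.
by apply: eq_bigr => s _; rewrite rmorphM /= conj_real_complex fC mulrCA mulrA.
Qed.

Lemma quad_eigenbasis (T : finType) (f : T -> T -> R) lam e (u : T -> R[i]) :
  (forall s t, f s t = f t s) -> eigenbasis f lam e ->
  quad f u = \sum_a (lam a)%:C * `|coef e u a| ^+ 2.
Proof.
move=> fC fe; rewrite /quad -(parseval _ _ fe); apply: eq_bigr => a _.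
by rewrite (coef_mul _ _ fC fe) normCKC mulrCA.
Qed.

Lemma exists_kernel (F : fieldType) (T I : finType) (phi : I -> T -> F) :
  (#|I| < #|T|)%N ->
  exists2 u : T -> F, (exists t, u t != 0) & forall i, \sum_t phi i t * u t = 0.
Proof.
move=> IT; pose M : 'M[F]_(#|T|, #|I|) := \matrix_(i, j) phi (enum_val j) (enum_val i).
have : kermx M != 0.
  by rewrite kermx_eq0 /row_free neq_ltn (leq_ltn_trans (rank_leq_col M)).
case/rowV0Pn => v /sub_kermxP vM v0; exists (fun t => v ord0 (enum_rank t)).
  have /rV0Pn[j vj] := v0.
  by exists (enum_val j); rewrite enum_valK.
move=> i; have /matrixP/(_ ord0 (enum_rank i)) := vM.
rewrite !mxE => {2}<-; rewrite -[LHS]sum_enum_val; apply: eq_bigr => k _.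
by rewrite !mxE enum_rankK enum_valK mulrC.
Qed.

(* A nonzero vector that vanishes on S, has no component on the eigenvectors of
   f above x and none on those of g below x would violate the comparison. *)
Lemma cnt_le_add (T : finType) (f g : T -> T -> R) (S : {set T}) x :
  (forall s t, f s t = f t s) -> (forall s t, g s t = g t s) ->
  (forall u, {in S, forall s, u s = 0} -> quad g u <= quad f u) ->
  (cnt f x <= cnt g x + #|S|)%N.
Proof.
move=> fC gC fg.
have [lam [e fe]] := eigenbasis_exists fC.
have [mu [e' ge]] := eigenbasis_exists gC.
rewrite (cnt_eigenbasis x fe) (cnt_eigenbasis x ge) leqNgt; apply/negP => lt.
pose A := [set t | lam t <= x]%SET; pose B := [set t | mu t <= x]%SET.
(* One linear condition per eigenvector of [f] above x, per eigenvector of [g] below or at x, and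
   per site of [S]. If the claim fails, there are fewer conditions than coordinates. *)
pose I : finType := ({t | t \in ~: A} + ({t | t \in B} + {t | t \in S}))%type.
pose phi (i : I) (t : T) : R[i] :=
  match i with
  | inl a => (e (val a) t)^*
  | inr (inl b) => (e' (val b) t)^*
  | inr (inr s) => (t == val s)%:R
  end.
have IT : (#|I| < #|T|)%N.
  rewrite !card_sum !card_sig -(cardsC A) addnC ltn_add2r.
  exact: lt.
have [u [t0 ut0] uphi] := exists_kernel phi IT.
have uA a : ~~ (lam a <= x) -> coef e u a = 0.
  move=> ax; have aA : a \in ~: A by rewrite !inE.
  exact: (uphi (inl (exist _ a aA))).
have uB b : mu b <= x -> coef e' u b = 0.
  move=> bx; have bB : b \in B by rewrite inE.
  exact: (uphi (inr (inl (exist _ b bB)))).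
have uS : {in S, forall s, u s = 0}.
  move=> s sS; have := uphi (inr (inr (exist _ s sS))).
  rewrite /= (bigD1 s) //= eqxx mul1r big1 ?addr0 // => t /negbTE ->.
  by rewrite mul0r.
have nf : \sum_a `|coef e u a| ^+ 2 = \sum_s (u s)^* * u s.
  by rewrite -(parseval u u fe); apply: eq_bigr => a _; rewrite normCKC.
have ng : \sum_a `|coef e' u a| ^+ 2 = \sum_s (u s)^* * u s.
  by rewrite -(parseval u u ge); apply: eq_bigr => a _; rewrite normCKC.
have qf : quad f u <= x%:C * \sum_s (u s)^* * u s.
  rewrite (quad_eigenbasis u fC fe) -nf mulr_sumr; apply: ler_sum => a _.
  have [ax|ax] := boolP (lam a <= x).
    by rewrite ler_wpM2r ?exprn_ge0 // lecR.
  by rewrite (uA a ax) normr0 expr0n !mulr0.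
(* Strictness comes from u being nonzero: by Parseval some coefficient survives, and it belongs to
   an eigenvalue above x. *)
have qg : x%:C * (\sum_s (u s)^* * u s) < quad g u.
  rewrite (quad_eigenbasis u gC ge) -ng mulr_sumr.
  have [/existsP[b ub]|/existsPn u0] := boolP [exists b, coef e' u b != 0].
    rewrite (bigD1 b) //= [ltRHS](bigD1 b) //=; apply: ltr_leD.
      rewrite ltr_pM2r ?exprn_gt0 ?normr_gt0 // ltcR ltNge.
      by apply: contra ub => /uB ->.
    apply: ler_sum => a _; have [ax|ax] := boolP (mu a <= x).
      by rewrite (uB a ax) normr0 expr0n !mulr0.
    by rewrite ler_wpM2r ?exprn_ge0 // lecR ltW // ltNge.
  have : \sum_a `|coef e' u a| ^+ 2 = 0.
    by apply: big1 => a _; have /negPn/eqP -> := u0 a; rewrite normr0 expr0n.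
  rewrite ng => /eqP; rewrite psumr_eq0 => [/allP/(_ t0)|s _].
    by rewrite mem_index_enum -normCKC expf_eq0 /= normr_eq0 (negbTE ut0) => /(_ isT).
  by rewrite -normCKC exprn_ge0.
by have := lt_le_trans qg (le_trans (fg u uS) qf); rewrite ltxx.
Qed.

Lemma eigenbasis_reindex (T T' : finType) (h : T' -> T) (f : T -> T -> R) lam e :
  bijective h -> eigenbasis f lam e ->
  eigenbasis (fun s t => f (h s) (h t)) (lam \o h) (fun a s => e (h a) (h s)).
Proof.
move=> hb [eO eE]; have hB : {on predT, bijective h} by apply: onW_bij.
have hi := bij_inj hb; split=> [s t|a s /=].
  by rewrite -(inj_eq hi) -eO [RHS](reindex h).
by rewrite -eE [RHS](reindex h).
Qed.

Lemma cnt_reindex (T T' : finType) (h : T' -> T) (f : T -> T -> R) x :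
  (forall s t, f s t = f t s) -> bijective h ->
  cnt (fun s t => f (h s) (h t)) x = cnt f x.
Proof.
move=> fC hb; have [lam [e fe]] := eigenbasis_exists fC.
rewrite (cnt_eigenbasis x (eigenbasis_reindex hb fe)) (cnt_eigenbasis x fe).
rewrite -(card_imset _ (bij_inj hb)); apply: eq_card => t.
rewrite !inE; apply/imsetP/idP => [[s]|tx]; first by rewrite inE => sx ->.
by case: hb => k hk kh; exists (k t); rewrite ?inE /= kh.
Qed.

(** The eigenvectors of the blocks, extended by zero, form an eigenbasis of the direct sum. *)
Lemma cnt_block (J T : finType) (f : J -> T -> T -> R) x :
  (forall j s t, f j s t = f j t s) ->
  cnt (fun p q : J * T => if p.1 == q.1 then f p.1 p.2 q.2 else 0) x
  = (\sum_j cnt (f j) x)%N.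
Proof.
move=> fC; have /choice[lam /choice[e fe]] : forall j, exists lam, exists e, eigenbasis (f j) lam e.
  by move=> j; apply: eigenbasis_exists.
pose lam' (p : J * T) := lam p.1 p.2.
pose e' (p q : J * T) : R[i] := if p.1 == q.1 then e p.1 p.2 q.2 else 0.
have fe' : eigenbasis (fun p q : J * T => if p.1 == q.1 then f p.1 p.2 q.2 else 0) lam' e'.
  split=> [[j s] [k t]|[j a] [k s]].
    rewrite -(pair_bigA _ (fun i a => e' (i, a) (j, s) * (e' (i, a) (k, t))^*)) /=.
    rewrite (bigD1 j) //= [X in _ + X]big1 => [|i ij]; last first.
      by apply: big1 => a _; rewrite /e' /= (negbTE ij) mul0r.
    rewrite addr0 /e' /= eqxx -[(j, s) == _]/((j == k) && (s == t)).
    case: eqVneq => jk /=; first by rewrite (fe j).1.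
    by apply: big1 => a _; rewrite conjC0 mulr0.
  rewrite -(pair_bigA _ (fun i t => (if k == i then f k s t else 0)%:C * e' (j, a) (i, t))) /=.
  rewrite (bigD1 k) //= [X in _ + X]big1 => [|i ik]; last first.
    by apply: big1 => t _; rewrite eq_sym (negbTE ik) mul0r.
  rewrite addr0 /e' /lam' /= eqxx; case: eqVneq => [<-|jk]; first exact: (fe j).2.
  by rewrite mulr0; apply: big1 => t _; rewrite mulr0.
rewrite (cnt_eigenbasis x fe') -sum1dep_card.
rewrite -(pair_big_dep xpredT (fun j t => lam j t <= x) (fun _ _ => 1%N)) /=.
by apply: eq_bigr => j _; rewrite (cnt_eigenbasis x (fe j)) -sum1dep_card.
Qed.

(** On vectors vanishing on [S] the two quadratic forms differ by a nonnegative diagonal form. The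
    choice of [S] yields all comparisons used later: empty for monotonicity in the potential, a
    single site for a rank one change, the faces of the blocks for cutting. *)
Lemma cnt_le_addT (T : finType) (f g : T -> T -> R) (S : {set T}) x :
  (forall s t, f s t = f t s) -> (forall s t, g s t = g t s) ->
  (forall s t, s \notin S -> t \notin S -> s != t -> f s t = g s t) ->
  (forall s, s \notin S -> g s s <= f s s) ->
  (cnt f x <= cnt g x + #|S|)%N.
Proof.
move=> fC gC fg1 fg2; apply: cnt_le_add => // u uS.
rewrite /quad; apply: ler_sum => s _.
have [sS|sS] := boolP (s \in S); first by rewrite (uS s sS) conjC0 !mul0r.
rewrite (bigD1 s) //= [leRHS](_ : _ =
  (u s)^* * ((f s s)%:C * u s + \sum_(t | t != s) (f s t)%:C * u t)); last first.
  by rewrite (bigD1 s).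
rewrite !mulrDr lerD //.
  rewrite !(mulrCA _ (_%:C)) -normCKC ler_wpM2r ?exprn_ge0 // lecR.
  exact: fg2.
rewrite le_eqVlt; apply/orP; left; apply/eqP; congr (_ * _).
apply: eq_bigr => t ts; have [tS|tS] := boolP (t \in S).
  by rewrite (uS t tS) !mulr0.
by rewrite fg1 // eq_sym.
Qed.

Lemma cnt_shift (T : finType) (f : T -> T -> R) c x :
  (forall s t, f s t = f t s) ->
  cnt (fun s t => f s t + (if s == t then c else 0)) (x + c) = cnt f x.
Proof.
move=> fC; have [lam [e fe]] := eigenbasis_exists fC.
have fe' : eigenbasis (fun s t => f s t + (if s == t then c else 0))
    (fun a => lam a + c) e.
  have [eO eE] := fe; split=> // a s.
  under eq_bigr do rewrite rmorphD mulrDl.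
  rewrite big_split /= eE rmorphD mulrDl; congr (_ + _).
  rewrite (bigD1 s) //= eqxx big1 ?addr0 // => t; rewrite eq_sym => /negbTE ->.
  by rewrite mul0r.
rewrite (cnt_eigenbasis _ fe) (cnt_eigenbasis _ fe'); apply: eq_card => t.
by rewrite !inE lerD2r.
Qed.

Lemma cnt_le_card (T : finType) (f : T -> T -> R) x :
  (forall s t, f s t = f t s) -> (cnt f x <= #|T|)%N.
Proof.
move=> fC; have [lam [e fe]] := eigenbasis_exists fC.
by rewrite (cnt_eigenbasis _ fe) max_card.
Qed.

Lemma cnt_right (T : finType) (f : T -> T -> R) x :
  exists2 c, 0 < c & forall y, y < x + c -> (cnt f y <= cnt f x)%N.
Proof.
rewrite /cnt; elim: (eigenvalues _) => [|z s [c c0 cs]] /=; first by exists 1.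
have [zx|xz] := leP z x.
  exists c => // y /cs yc; exact: leq_add (leq_b1 _) yc.
exists (Num.min c (z - x)); first by rewrite lt_min c0 subr_gt0.
move=> y; rewrite -ltrBlDl lt_min ltrBlDl ltrD2r => /andP[/cs yc yz].
by rewrite leNgt yz.
Qed.

End Spectrum.

(** * Cutting boxes into blocks *)

(** Bounds the outer shell of a cube of side a by its 2k faces. The truncated subtraction also
    covers a = 1, the box with L = 0. *)
Lemma expn_sub2 (a k : nat) : (a ^ k <= (a - 2) ^ k + k * 2 * a ^ k.-1)%N.
Proof.
elim: k => [|k IH]; first by rewrite !expn0.
have h : (k * 2 * a ^ k.-1 * a = k * 2 * a ^ k)%N.
  by case: k {IH} => [|k] /=; rewrite ?mul0n // expnS; nia.
have h2 : ((a - 2) ^ k <= a ^ k)%N by case: k {IH h} => // k; rewrite leq_exp2r // leq_subr.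
have := leq_mul IH (leqnn a); rewrite mulnDl h -expnSr => /leq_trans; apply.
rewrite expnSr /=; move: (a ^ k)%N ((a - 2) ^ k)%N h2 => b c; nia.
Qed.

Section Boxes.
Context {R : realType} {d : nat}.
Implicit Types (v : site d -> R) (m n : site d).

Lemma dist1C m n : dist1 m n = dist1 n m.
Proof. by apply: eq_bigr => i _; rewrite !ffunE distnC. Qed.

Lemma anderson_std_basis v m n :
  anderson v (std_basis R m) n = (dist1 m n == 1%N)%:R + v n * (n == m)%:R.
Proof.
rewrite /anderson /laplacian /std_basis; congr (_ + _).
have [mn|mn] := eqVneq (dist1 m n) 1%N.
  rewrite -(fsbig_widen [set m]) ?fsbig_set1 ?eqxx // => k; first by move=> /= ->.
  by move=> /= [_ /eqP/negbTE ->].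
rewrite fsbig1 // => k /= kn; case: eqP => // km.
by move: mn; rewrite -km kn.
Qed.

Definition ham (T : finType) v (phi : T -> site d) (s t : T) : R :=
  anderson v (std_basis R (phi t)) (phi s).

Lemma ham_sym (T : finType) v (phi : T -> site d) s t : ham v phi s t = ham v phi t s.
Proof.
rewrite /ham !anderson_std_basis dist1C; congr (_ + _).
by rewrite eq_sym; case: eqP => [->|]; rewrite ?mulr0.
Qed.

Lemma ham_translate (T : finType) v (phi : T -> site d) m s t :
  ham v (fun r => phi r + m) s t = ham (fun n => v (n + m)) phi s t.
Proof.
rewrite /ham !anderson_std_basis (inj_eq (addIr m)) /dist1; congr ((_ == _)%:R + _).
by apply: eq_bigr => i _; rewrite opprD addrACA subrr addr0.
Qed.

Definition box_cnt v L x := cnt (ham v (@box_site d L)) x.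

Lemma eig_count_box_cnt v L x : eig_count v L `]-oo, x] = box_cnt v L x.
Proof.
rewrite /eig_count /box_cnt /cnt; apply: eq_count => y.
by rewrite in_itv.
Qed.

Section Blocks.
Variables j L : nat.
Local Notation M := (j * L.*2.+1 + L)%N.

Lemma glue_subproof (p : box d j * box d L) i :
  (p.1 i * L.*2.+1 + p.2 i < M.*2.+1)%N.
Proof.
have := ltn_ord (p.1 i); have := ltn_ord (p.2 i); nia.
Qed.

(** The value of [M] is forced by 2M+1 = (2j+1)(2L+1). Each coordinate is split by Euclidean
    division by 2L+1: the quotient selects the block, the remainder the position inside it. *)
Definition glue (p : box d j * box d L) : box d M :=
  [ffun i => Ordinal (glue_subproof p i)].

Lemma glue_bij : bijective glue.
Proof.
apply: inj_card_bij; last first.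
  rewrite card_prod !card_box -expnMn leq_eqVlt; apply/orP; left.
  by apply/eqP; congr (_ ^ _)%N; nia.
move=> [q r] [q' r'] /ffunP eq.
have h i : q i = q' i /\ r i = r' i.
  have := congr1 val (eq i); rewrite !ffunE /= => e.
  have := ltn_ord (r i); have := ltn_ord (r' i) => h1 h2.
  have := congr1 (divn^~ L.*2.+1) e; rewrite !divnMDl // !divn_small // !addn0 => eq1.
  by split; apply/val_inj => //; move: e; rewrite eq1 => /addnI.
by congr pair; apply/ffunP => i; have [] := h i.
Qed.

Definition block_shift (q : box d j) : site d := [ffun i => L.*2.+1%:Z * box_site q i].

Lemma box_site_glue q r : box_site (glue (q, r)) = box_site r + block_shift q.
Proof.
apply/ffunP => i; rewrite !ffunE /=.
lia.
Qed.

(** Number of blocks times the shell bound of [expn_sub2] for one block; per block it is independent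
    of j. *)
Definition block_error := ((j.*2.+1) ^ d * (d * 2 * L.*2.+1 ^ d.-1))%N.

Definition block_boundary : {set box d j * box d L} :=
  [set p : box d j * box d L | [exists i, (p.2 i == 0 :> nat) || (p.2 i == L.*2 :> nat)]]%SET.

Lemma card_block_boundary : (#|block_boundary| <= block_error)%N.
Proof.
pose B := [set r : box d L | [exists i, (r i == 0 :> nat) || (r i == L.*2 :> nat)]]%SET.
pose I := [pred a : 'I_(L.*2.+1) | ~~ ((a == 0 :> nat) || (a == L.*2 :> nat))].
have -> : block_boundary = finset.setX finset.setT B.
  by apply/setP => p; rewrite !inE.
rewrite cardsX cardsT card_box leq_mul2l; apply/orP; right.
have cB : #|~: B| = (#|I| ^ d)%N.
  rewrite -[in RHS](card_ord d) -card_ffun_on; apply: eq_card => r.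
  rewrite !inE negb_exists; apply/forallP/ffun_onP => h i; have := h i;
    by rewrite inE.
(* Only an inequality, as the two extreme coordinates coincide when L = 0. *)
have cI : (L.*2.+1 - 2 <= #|I|)%N.
  rewrite leq_subLR -[leqLHS](card_ord L.*2.+1) -(cardC I) addnC leq_add2r.
  apply: leq_trans (_ : #|[set ord0; ord_max : 'I_(L.*2.+1)]%SET| <= 2)%N; last first.
    by rewrite cards2; case: (_ != _).
  apply: subset_leq_card; apply/fintype.subsetP => a.
  by rewrite !inE negbK.
have := cardsC B; rewrite cB card_box; have := expn_sub2 L.*2.+1 d.
have : ((L.*2.+1 - 2) ^ d <= #|I| ^ d)%N by case: (d) => // n; rewrite leq_exp2r.
lia.
Qed.

Definition block_ham v (p q : box d j * box d L) : R :=
  if p.1 == q.1 then ham (fun n => v (n + block_shift p.1)) (@box_site d L) p.2 q.2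
  else 0.

(** Within a block this is translation. Sites of different blocks that avoid the faces differ by
    more than one in every coordinate where the block indices differ, so no hopping term joins
    them. *)
Lemma block_hamE v p q : p \notin block_boundary -> q \notin block_boundary ->
  ham v (@box_site d M) (glue p) (glue q) = block_ham v p q.
Proof.
case: p q => [k s] [k' t] sB tB; rewrite /block_ham /=.
case: eqP => [<-|kk'].
  by rewrite -ham_translate /ham !box_site_glue.
rewrite /ham anderson_std_basis (inj_eq (@box_site_inj _ _)) (inj_eq (bij_inj glue_bij)).
have -> : (k, s) == (k', t) = false by apply/negP => /eqP[].
rewrite mulr0 addr0; case: eqP => // dist.
have [i ki] : exists i, k i != k' i.
  by apply/existsP; apply: contra_notT kk' => /existsPn h; apply/ffunP => i; apply/eqP/negPn.
have : (absz ((box_site (glue (k', t)) - box_site (glue (k, s)))%R i) <= 1)%N.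
  by rewrite -dist /dist1 (bigD1 i) //= leq_addr.
rewrite !box_site_glue !ffunE.
have : k i != k' i :> nat by [].
move: sB tB; rewrite !inE => /existsPn/(_ i) /= + /existsPn/(_ i) /=.
have := ltn_ord (s i); have := ltn_ord (t i).
move: (nat_of_ord (s i)) (nat_of_ord (t i)) (nat_of_ord (k i)) (nat_of_ord (k' i)) => a b a' b'.
rewrite neq_ltn => ha hb h1 h2 /orP[/subnKC <-|/subnKC <-]; nia.
Qed.

Lemma cnt_blocks v x :
  (box_cnt v M x <=
     \sum_(q : box d j) box_cnt (fun n => v (n + block_shift q)%R) L x + block_error)%N /\
  (\sum_(q : box d j) box_cnt (fun n => v (n + block_shift q)%R) L x <=
     box_cnt v M x + block_error)%N.
Proof.
have -> : (\sum_(q : box d j) box_cnt (fun n => v (n + block_shift q)%R) L x)%N =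
    cnt (block_ham v) x.
  rewrite -cnt_block // => k s t; exact: ham_sym.
rewrite /box_cnt -(cnt_reindex _ _ glue_bij); last exact: ham_sym.
have symb s t : block_ham v s t = block_ham v t s.
  by rewrite /block_ham eq_sym; case: eqP => // ->; rewrite ham_sym.
have bd := card_block_boundary.
split; (apply: leq_trans (leq_add (leqnn _) bd); apply: cnt_le_addT => //).
- by move=> s t; exact: ham_sym.
- by move=> s t sS tS _; rewrite block_hamE.
- by move=> s sS; rewrite block_hamE.
- by move=> s t; exact: ham_sym.
- by move=> s t sS tS _; rewrite block_hamE.
- by move=> s sS; rewrite block_hamE.
Qed.

End Blocks.
End Boxes.

(** * Monotonicity and measurability of the count as a function of the diagonal *)

Section TupleCount.
Context {R : realType}.

Lemma sum_ltn_ord n c : (\sum_(k < n) (k < c) = minn n c)%N.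
Proof. by elim: n => [|n IH]; rewrite ?big_ord0 ?min0n // big_ord_recr /= IH; lia. Qed.

(* Diagonal entries as a tuple, so that the count becomes a random variable on
   the product space. *)
Definition tcnt n (h : 'I_n -> 'I_n -> R) x (t : n.-tuple R) : nat :=
  cnt (fun i j => h i j + (if i == j then tnth t i else 0)) x.

Section Measurability.
Variables (n : nat) (h : 'I_n -> 'I_n -> R).
Hypothesis hC : forall i j, h i j = h j i.

Lemma tcnt_sym (t : n.-tuple R) i j :
  h i j + (if i == j then tnth t i else 0) = h j i + (if j == i then tnth t j else 0).
Proof. by rewrite hC eq_sym; case: eqP => // ->. Qed.

Lemma tcnt_anti x (t t' : n.-tuple R) :
  (forall i, tnth t i <= tnth t' i) -> (tcnt h x t' <= tcnt h x t)%N.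
Proof.
move=> tt'; rewrite -[leqRHS]addn0 -(cards0 'I_n).
apply: cnt_le_addT => [i j|i j|i j _ _ /negbTE ->|i _] //; try exact: tcnt_sym.
by rewrite eqxx lerD2l.
Qed.

Lemma tcnt_site x (t t' : n.-tuple R) k :
  (forall i, i != k -> tnth t i = tnth t' i) -> (tcnt h x t <= tcnt h x t' + 1)%N.
Proof.
move=> tt'; rewrite -(cards1 k).
apply: cnt_le_addT => [i j|i j|i j _ _ /negbTE ->|i] //; try exact: tcnt_sym.
by rewrite inE eqxx => /tt' ->.
Qed.

Lemma tcnt_shift x c (t : n.-tuple R) :
  tcnt h (x + c) [tuple tnth t i + c | i < n] = tcnt h x t.
Proof.
rewrite /tcnt -[RHS](cnt_shift c x (tcnt_sym t)); congr (cnt _ _).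
apply/funext => i; apply/funext => j; rewrite -addrA tnth_mktuple; congr (_ + _).
by case: eqP; rewrite ?addr0.
Qed.

Lemma tcnt_le x (t : n.-tuple R) : (tcnt h x t <= n)%N.
Proof. by rewrite -[leqRHS](card_ord n) cnt_le_card //; exact: tcnt_sym. Qed.

(* The count is decreasing in the diagonal, so its superlevel sets are
   approximated from rational diagonals slightly above the given one; the
   spectral shift and right continuity in x absorb the discrepancy. *)
Lemma tcnt_superlevel x k :
  [set t : n.-tuple R | (k <= tcnt h x t)%N] =
  \bigcap_(m : nat) \bigcup_(q : n.-tuple rat)
    (if (k <= tcnt h (x + m.+1%:R^-1) (map_tuple ratr q))%N
     then [set t | forall i, tnth t i <= ratr (tnth q i)] else set0).
Proof.
apply/seteqP; split=> [t /= kt m _|t /= tm].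
  have e0 : 0 < m.+1%:R^-1 :> R by rewrite invr_gt0.
  have /choice[q tq] : forall i, exists q : rat,
      tnth t i < ratr q < tnth t i + m.+1%:R^-1.
    move=> i; have /rat_in_itvoo[q] : tnth t i < tnth t i + m.+1%:R^-1 by rewrite ltrDl.
    by rewrite in_itv /= => qi; exists q.
  exists [tuple q i | i < n] => //.
  rewrite ifT => [i|]; first by rewrite tnth_mktuple; have /andP[/ltW] := tq i.
  apply: leq_trans kt _; rewrite -(tcnt_shift x m.+1%:R^-1 t).
  apply: tcnt_anti => i; rewrite tnth_map !tnth_mktuple.
  by have /andP[_ /ltW] := tq i.
have [c c0 ct] := cnt_right (fun i j => h i j + (if i == j then tnth t i else 0)) x.
have [m mc] : exists m : nat, m.+1%:R^-1 < c.
  have [m] := ltr_add_invr c0.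
  by rewrite add0r => mc; exists m.
have [q _] := tm m Logic.I; case: ifP => // kq tq.
apply: leq_trans (ct (x + m.+1%:R^-1) _); last by rewrite ltrD2l.
apply: leq_trans kq _; apply: tcnt_anti => i.
by rewrite tnth_map.
Qed.

Lemma measurable_tcnt x :
  measurable_fun setT (fun t : n.-tuple (measurableTypeR R) => (tcnt h x t)%:R : R).
Proof.
(* Layer-cake formula: a count bounded by n is the sum of the indicators of its superlevel sets, so
   only these have to be measurable. *)
have sumE t : (tcnt h x t)%:R = \sum_(k < n) ((k < tcnt h x t)%N)%:R :> R.
  by rewrite -natr_sum sum_ltn_ord (minn_idPr (tcnt_le x t)).
under eq_fun do rewrite sumE.
apply: measurable_sum => k.
rewrite (_ : (fun t => _) = \1_[set t : n.-tuple R | (k < tcnt h x t)%N]); last first.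
  by apply/funext => t; rewrite indicE mem_setE.
apply: measurable_realfun.measurable_indic; rewrite tcnt_superlevel.
apply: bigcapT_measurable => m; apply: countable_bigcupT_measurable => // q.
case: ifP => _; last exact: measurable0.
rewrite (_ : [set t | _] = \bigcap_(i in [set: 'I_n]) ((@tnth n R)^~ i) @^-1` `]-oo, ratr (tnth q i)]).
  apply: fin_bigcap_measurable => // i _.
  rewrite -[X in measurable X]setTI.
  apply: (@measurable_tnth _ (measurableTypeR R) n i measurableT).
  exact: measurable_itv.
by apply/seteqP; split=> t /= h' i; have := h' i; rewrite /= in_itv /=; auto.
Qed.

End Measurability.
End TupleCount.

(** * Finite families of i.i.d. variables *)

Section TupleMeasure.
Context {R : realType} {disp : measure_display} {T : measurableType disp} {n : nat}.

Definition rectangles : set (set (n.-tuple T)) :=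
  [set A | exists2 B : 'I_n -> set T, (forall i, measurable (B i)) &
     A = [set t | forall i, B i (tnth t i)]].

Lemma measurable_rectangles : rectangles `<=` measurable.
Proof.
move=> _ [B mB ->].
rewrite (_ : [set t | _] = \bigcap_(i in [set: 'I_n]) ((@tnth n T)^~ i) @^-1` B i).
  apply: fin_bigcap_measurable => // i _; rewrite -[X in measurable X]setTI.
  exact: (@measurable_tnth _ T n i measurableT).
by apply/seteqP; split=> t /= h i *; apply: h.
Qed.

Lemma tuple_measurableE : measurable = <<s rectangles>>.
Proof.
apply/seteqP; split; last first.
  apply: smallest_sub; last exact: measurable_rectangles.
  exact: sigma_algebra_measurable.
apply: smallest_sub; first exact: smallest_sigma_algebra.
apply: (big_ind (fun S => S `<=` <<s rectangles>>)) => [//|S1 S2 h1 h2|i _].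
  by rewrite subUset.
move=> _ [B mB <-].
apply: sub_gen_smallest; exists (fun k => if k == i then B else setT).
  by move=> k; case: ifP.
rewrite setTI; apply/seteqP; split=> t /=.
  by move=> Bt k; case: eqP => // ->.
by move=> /(_ i); rewrite eqxx.
Qed.

(** Rectangles are stable under intersection, generate the sigma-algebra and include the whole
    space, so the pi-system uniqueness theorem applies with a constant exhausting sequence. *)
Lemma tuple_measure_unique (m1 m2 : {measure set (n.-tuple T) -> \bar R}) :
  (m1 setT < +oo)%E -> (forall A, rectangles A -> m1 A = m2 A) ->
  forall A, measurable A -> m1 A = m2 A.
Proof.
move=> foo m12 A mA.
apply: (measure_unique rectangles (fun=> setT) tuple_measurableE) => //.
- move=> _ _ [B mB ->] [C mC ->]; exists (fun i => B i `&` C i).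
    by move=> i; exact: measurableI.
  apply/seteqP; split=> t /=; first by move=> [h1 h2] i; split.
  by move=> h; split=> i; have [] := h i.
- by move=> i; exists (fun=> setT) => //; apply/seteqP; split.
- by rewrite bigcup_const.
Qed.

End TupleMeasure.

Section Sample.
Context {R : realType} {disp : measure_display} {Omega : measurableType disp}.
Context (P : probability Omega R) (K : choiceType).
Variable X : K -> {RV P >-> measurableTypeR R}.

Definition sample n (phi : 'I_n -> K) (w : Omega) : n.-tuple (measurableTypeR R) :=
  [tuple X (phi i) w | i < n].

Lemma measurable_sample n (phi : 'I_n -> K) : measurable_fun setT (sample phi).
Proof.
apply/measurable_fun_tnthP => i.
by rewrite (_ : _ \o _ = X (phi i)) //; apply/funext => w; rewrite /= tnth_mktuple.
Qed.

HB.instance Definition _ n (phi : 'I_n -> K) :=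
  isMeasurableFun.Build _ _ _ _ (sample phi) (measurable_sample phi).

Hypothesis Xind : mutually_independent X.

Lemma sample_rectangle n (phi : 'I_n -> K) (B : 'I_n -> set (measurableTypeR R)) :
  injective phi -> (forall i, measurable (B i)) ->
  P (sample phi @^-1` [set t | forall i, B i (tnth t i)]) =
  (\prod_(i < n) P (X (phi i) @^-1` B i))%E.
Proof.
(* Independence asks for one set per index of [K]. Injectivity of [phi] makes the transport of [B]
   well defined; off its image the default [setT] only has to be measurable. *)
move=> phiI mB; pose B' k := if [pick i | phi i == k] is Some i then B i else setT.
have B'E i : B' (phi i) = B i.
  by rewrite /B'; case: pickP => [j /eqP/phiI ->//|/(_ i)]; rewrite eqxx.
have := Xind (s := map phi (enum 'I_n)) (B := B').
rewrite map_inj_uniq // enum_uniq => /(_ isT).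
rewrite big_map big_enum /=; under eq_bigr do rewrite B'E.
move=> <-; last by move=> k; rewrite /B'; case: pickP.
congr (P _); apply/seteqP; split=> w /=.
  move=> h k /= /mapP[i _ ->]; rewrite /= B'E.
  by have := h i; rewrite tnth_mktuple.
move=> h i; rewrite tnth_mktuple -B'E; apply: h.
by rewrite /= map_f // mem_enum.
Qed.

(** With [A] fixed, both sides are finite measures in [B], so it suffices to compare them on
    rectangles, where the claim is the product rule for all n+1 coordinates. *)
Lemma sample_cons n (phi : 'I_n.+1 -> K) A B : injective phi ->
  measurable A -> measurable B ->
  P (X (phi ord0) @^-1` A `&` sample (phi \o lift ord0) @^-1` B) =
  (P (X (phi ord0) @^-1` A) * P (sample (phi \o lift ord0) @^-1` B))%E.
Proof.
move=> phiI mA mB.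
have mXA : measurable (X (phi ord0) @^-1` A) by apply: measurable_funPTI.
have fin : P (X (phi ord0) @^-1` A) \is a fin_num by exact: fin_num_measure.
pose r : {nonneg R} := NngNum (fine_ge0 (measure_ge0 P (X (phi ord0) @^-1` A))).
pose m1' : {measure set _ -> \bar R} := pushforward (mrestr P mXA) (sample (phi \o lift ord0)).
pose m1 := m1' (measurable_sample _).
pose m2 : {measure set _ -> \bar R} := mscale r (distribution P (sample (phi \o lift ord0))).
have m1E C : m1 C = P (X (phi ord0) @^-1` A `&` sample (phi \o lift ord0) @^-1` C).
  by rewrite /m1 /m1' /= /pushforward /mrestr setIC.
have m2E C : m2 C = (P (X (phi ord0) @^-1` A) * P (sample (phi \o lift ord0) @^-1` C))%E.
  by rewrite /m2 /= /mscale /= fineK.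
rewrite -m1E -m2E; apply: tuple_measure_unique => //.
  by rewrite m1E preimage_setT setIT ltey_eq fin.
move=> _ [C mC ->]; rewrite m1E m2E.
have phiI' : injective (phi \o lift ord0) by move=> i j /phiI/lift_inj.
rewrite sample_rectangle //.
pose D i := if unlift ord0 i is Some k then C k else A.
have DA : D ord0 = A by rewrite /D unlift_none.
have DC i : D (lift ord0 i) = C i by rewrite /D liftK.
have mD i : measurable (D i) by rewrite /D; case: unliftP.
have := sample_rectangle phiI mD; rewrite big_ord_recl DA.
under eq_bigr do rewrite DC.
move=> <-; congr (P _); apply/seteqP; split=> w /=.
  move=> [Aw Cw] i; rewrite tnth_mktuple; case: (unliftP ord0 i) => [k|] ->.
    by rewrite DC; have := Cw k; rewrite tnth_mktuple.
  by rewrite DA.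
move=> Dw; split; first by have := Dw ord0; rewrite DA tnth_mktuple.
by move=> i; have := Dw (lift ord0 i); rewrite DC !tnth_mktuple.
Qed.

End Sample.

Lemma sample_stationary (R : realType) (disp : measure_display)
    (Omega : measurableType disp) (P : probability Omega R) (K : choiceType)
    (X : K -> {RV P >-> measurableTypeR R}) mu n (phi psi : 'I_n -> K) A :
  iid_with_law X mu -> injective phi -> injective psi -> measurable A ->
  distribution P (sample X phi) A = distribution P (sample X psi) A.
Proof.
move=> [Xi Xm] phiI psiI mA; apply: tuple_measure_unique => //.
  by rewrite /= probability_setT ltry.
move=> _ [B mB ->].
apply: etrans (sample_rectangle Xi phiI mB) _.
apply: etrans (esym (sample_rectangle Xi psiI mB)).
apply: eq_bigr => i _.
exact: etrans (Xm (phi i) _ (mB i)) (esym (Xm (psi i) _ (mB i))).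
Qed.

(** * Bounded random variables and their second moments *)

Section BoundedMeasurable.
Context {R : realType} {disp : measure_display} {T : measurableType disp}.
Implicit Types f g : T -> R.

Definition bounded_measurable f :=
  measurable_fun setT f /\ exists C, forall x, `|f x| <= C.

Lemma bounded_measurable_cst c : bounded_measurable (fun=> c).
Proof. by split; [exact: measurable_cst | exists `|c|]. Qed.

Lemma bounded_measurableD f g : bounded_measurable f -> bounded_measurable g ->
  bounded_measurable (fun x => f x + g x).
Proof.
move=> [mf [C fC]] [mg [D gD]]; split; first exact: measurable_funD.
by exists (C + D) => x; rewrite (le_trans (ler_normD _ _)) ?lerD.
Qed.

Lemma bounded_measurableM f g : bounded_measurable f -> bounded_measurable g ->
  bounded_measurable (fun x => f x * g x).
Proof.
move=> [mf [C fC]] [mg [D gD]]; split; first exact: measurable_funM.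
by exists (C * D) => x; rewrite normrM ler_pM.
Qed.

Context (P : probability T R).

Lemma bounded_integrable f : bounded_measurable f -> P.-integrable setT (EFin \o f).
Proof.
move=> [mf [C fC]]; apply: (le_integrable _ _ _ (finite_measure_integrable_cst P C measurableT)) => //.
  exact/measurable_EFinP.
by move=> x _; rewrite /= lee_fin (le_trans (fC x)) // ler_norm.
Qed.

Lemma Rintegral_prob_cst (c : R) : \int[P]_x c = c.
Proof. by rewrite Rintegral_cst //= probability_setT mulr1. Qed.

Lemma Rintegral_bounded f C : measurable_fun setT f -> (forall x, `|f x| <= C) ->
  `|\int[P]_x f x| <= C.
Proof.
move=> mf fC; have fb : bounded_measurable f by split=> //; exists C.
rewrite ler_norml -{1}(Rintegral_prob_cst (- C)) -{2}(Rintegral_prob_cst C).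
by apply/andP; split; apply: le_Rintegral => //; try exact: bounded_integrable;
  try (apply: bounded_integrable; exact: bounded_measurable_cst);
  move=> x _; have := fC x; rewrite ler_norml => /andP[].
Qed.

Lemma Rintegral_sqr_center f m : bounded_measurable f ->
  \int[P]_x (f x - m) ^+ 2 =
  \int[P]_x (f x ^+ 2) - 2 * m * \int[P]_x f x + m ^+ 2.
Proof.
move=> bf; have bf2 := bounded_measurableM bf bf.
have bc := bounded_measurableM (bounded_measurable_cst (- (2 * m))) bf.
rewrite (_ : (fun x => (f x - m) ^+ 2) =
   fun x => (f x * f x + (- (2 * m)) * f x) + m ^+ 2); last first.
  by apply/funext => x; ring.
rewrite RintegralD //; last 2 first.
- by apply: bounded_integrable; exact: bounded_measurableD.
- by apply: bounded_integrable; exact: bounded_measurable_cst.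
rewrite RintegralD //; try exact: bounded_integrable.
rewrite RintegralZl //; last exact: bounded_integrable.
by rewrite Rintegral_prob_cst mulNr.
Qed.

(** One-variable case of the variance bound: the mean is an average of values of [f], hence within
    [c] of each of them. *)
Lemma second_moment_le f c : bounded_measurable f ->
  (forall x y, `|f x - f y| <= c) ->
  \int[P]_x (f x ^+ 2) <= (\int[P]_x f x) ^+ 2 + c ^+ 2.
Proof.
move=> bf fc; set m := \int[P]_x f x.
have fm x : `|f x - m| <= c.
  have bB : bounded_measurable (fun y => f x - f y).
    apply: bounded_measurableD; first exact: bounded_measurable_cst.
    have := bounded_measurableM (bounded_measurable_cst (-1)) bf.
    by under eq_fun do rewrite mulN1r.
  rewrite (_ : f x - m = \int[P]_y (f x - f y)).
    by apply: Rintegral_bounded => //; exact: bB.1.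
  rewrite RintegralB ?Rintegral_prob_cst //; apply: bounded_integrable => //.
  exact: bounded_measurable_cst.
have bB : bounded_measurable (fun x => (f x - m) * (f x - m)).
  by apply: bounded_measurableM; apply: bounded_measurableD => //; exact: bounded_measurable_cst.
have : \int[P]_x (f x - m) ^+ 2 <= c ^+ 2.
  apply: le_trans (ler_norm _) _; apply: Rintegral_bounded; first exact: bB.1.
  move=> x; rewrite normrX; have := fm x; have := normr_ge0 (f x - m).
  by move: `|f x - m| => u u0 uc; rewrite lerXn2r ?nnegrE // (le_trans u0).
by rewrite Rintegral_sqr_center // -/m; lra.
Qed.

End BoundedMeasurable.

(** * Integrating out one coordinate, and the Efron-Stein inequality *)

Section SampleExpectation.
Context {R : realType} {disp : measure_display} {Omega : measurableType disp}.
Context (P : probability Omega R) (K : choiceType).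
Variable X : K -> {RV P >-> measurableTypeR R}.
Hypothesis Xind : mutually_independent X.

Lemma bounded_measurable_comp {d1 d2} {T1 : measurableType d1} {T2 : measurableType d2}
    (h : T1 -> T2) (f : T2 -> R) :
  measurable_fun setT h -> bounded_measurable f -> bounded_measurable (f \o h).
Proof.
move=> mh [mf [C fC]]; split; first exact: measurableT_comp.
by exists C => x; exact: fC.
Qed.

Lemma sampleE n (phi : 'I_n.+1 -> K) w :
  sample X phi w = [tuple of X (phi ord0) w :: sample X (phi \o lift ord0) w].
Proof.
apply: eq_from_tnth => i; rewrite tnth_mktuple.
case: (unliftP ord0 i) => [k|] ->; last by rewrite tnth0.
by rewrite tnthS tnth_mktuple.
Qed.

(** Fubini for a sample: by [sample_cons] the joint law of the first coordinate and the rest is the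
    product of their laws. Measurability of the partial integral [g] is needed to iterate. *)
Lemma Rintegral_sample_cons n (phi : 'I_n.+1 -> K)
    (f : n.+1.-tuple (measurableTypeR R) -> R)
    (g := fun y : n.-tuple (measurableTypeR R) =>
       \int[distribution P (X (phi ord0))]_x f [tuple of x :: y]) :
  injective phi -> bounded_measurable f ->
  bounded_measurable g /\
  \int[P]_w f (sample X phi w) = \int[P]_w g (sample X (phi \o lift ord0) w).
Proof.
move=> phiI bf.
pose mu := distribution P (X (phi ord0)).
pose rest := sample X (phi \o lift ord0).
pose rho := distribution P rest.
pose F (z : measurableTypeR R * n.-tuple (measurableTypeR R)) := f [tuple of z.1 :: z.2].
have mcons : measurable_fun setT
    (fun z : measurableTypeR R * n.-tuple (measurableTypeR R) => [tuple of z.1 :: z.2]).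
  by apply: measurable_cons; [exact: measurable_fst | exact: measurable_snd].
have bF : bounded_measurable F := bounded_measurable_comp mcons bf.
pose h w := (X (phi ord0) w, rest w).
have mh : measurable_fun setT h.
  by apply: measurable_fun_pair; [|exact: measurable_sample].
pose nu' : {measure set (measurableTypeR R * n.-tuple (measurableTypeR R)) -> \bar R} :=
  pushforward P h.
pose nu := nu' mh.
have nuE A : measurable A -> (mu \x rho)%E A = nu A.
  move=> mA; apply: product_measure_unique => // B C mB mC.
  exact: sample_cons.
have iF : (mu \x rho)%E.-integrable setT (EFin \o F) by exact: bounded_integrable.
have bfy (y : n.-tuple (measurableTypeR R)) : bounded_measurable (fun x : measurableTypeR R => f [tuple of x :: y]).
  apply: (@bounded_measurable_comp _ _ _ _ (fun x => [tuple of x :: y]) f) => //.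
  by apply: measurable_cons; [exact: measurable_id | exact: measurable_cst].
have gE : fubini_G mu (EFin \o F) = EFin \o g.
  apply/funext => y; rewrite /fubini_G /g /= /Rintegral fineK //.
  by apply: integrable_fin_num => //; exact: (bounded_integrable _ (bfy y)).
have bg : bounded_measurable g.
  split; last first.
    have [mf [C fC]] := bf; exists C => y; apply: Rintegral_bounded => //.
    exact: (bfy y).1.
  by apply/measurable_EFinP; rewrite -gE; exact: (measurable_fubini_G iF).
split=> //.
rewrite /Rintegral; congr fine.
transitivity (\int[nu]_z (F z)%:E)%E.
  rewrite (integral_pushforward mh) //; last 2 first.
  - by apply/measurable_EFinP; exact: bF.1.
  - exact: (bounded_integrable P (bounded_measurable_comp mh bF)).
  by apply: eq_integral => w _ /=; rewrite sampleE.
rewrite -(eq_measure_integral nu (fun A mA _ => nuE A mA)).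
rewrite -integral21_prod_meas1 // gE integral_distribution //.
  by apply/measurable_EFinP; exact: bg.1.
exact: (bounded_integrable P (bounded_measurable_comp (measurable_sample _ _) bg)).
Qed.

(** Tensorisation. For a fixed tail, [second_moment_le] costs c^2 and leaves the square of the
    partial mean; that partial mean keeps the bounded differences in the remaining coordinates, so
    the induction hypothesis applies to it. *)
Lemma sample_second_moment_le n (phi : 'I_n -> K)
    (f : n.-tuple (measurableTypeR R) -> R) c :
  injective phi -> bounded_measurable f ->
  (forall k (t t' : n.-tuple (measurableTypeR R)),
     (forall i, i != k -> tnth t i = tnth t' i) -> `|f t - f t'| <= c) ->
  \int[P]_w (f (sample X phi w) ^+ 2) <=
  (\int[P]_w f (sample X phi w)) ^+ 2 + n%:R * c ^+ 2.
Proof.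
elim: n phi f => [|n IH] phi f phiI bf fc.
  have fE w : f (sample X phi w) = f [tuple] by rewrite (tuple0 (sample X phi w)).
  under eq_Rintegral do rewrite fE.
  under [X in _ <= X ^+ 2 + _]eq_Rintegral do rewrite fE.
  by rewrite !Rintegral_prob_cst mul0r addr0.
have bf2 := bounded_measurableM bf bf.
have [bg fg] := Rintegral_sample_cons phiI bf.
have [bg2 fg2] := Rintegral_sample_cons phiI bf2.
rewrite fg; apply: (le_trans (y := \int[P]_w
   ((\int[distribution P (X (phi ord0))]_x f [tuple of x :: sample X (phi \o lift ord0) w]) ^+ 2 + c ^+ 2))).
  rewrite [leLHS]fg2.
  have ms := measurable_sample X (phi \o lift ord0).
  apply: le_Rintegral => //.
  - exact: (bounded_integrable P (bounded_measurable_comp ms bg2)).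
  - apply: bounded_integrable; apply: bounded_measurableD; last exact: bounded_measurable_cst.
    exact: (bounded_measurable_comp ms (bounded_measurableM bg bg)).
  move=> w _; apply: second_moment_le.
    apply: (@bounded_measurable_comp _ _ _ _ (fun x => [tuple of x :: sample X (phi \o lift ord0) w]) f) => //.
    by apply: measurable_cons; [exact: measurable_id | exact: measurable_cst].
  move=> x x'; apply: (fc ord0) => i; case: (unliftP ord0 i) => [k|] -> //.
  by rewrite !tnthS.
set g := (fun y : n.-tuple (measurableTypeR R) => \int[distribution P (X (phi ord0))]_x f [tuple of x :: y]) in fg bg *.
have ms := measurable_sample X (phi \o lift ord0).
rewrite RintegralD //; last 2 first.
- exact: (bounded_integrable P (bounded_measurable_comp ms (bounded_measurableM bg bg))).
- by apply: bounded_integrable; exact: bounded_measurable_cst.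
rewrite Rintegral_prob_cst -natr1 mulrDl mul1r addrA lerD2r.
apply: (IH (phi \o lift ord0) g) => //.
  by move=> i j /phiI/lift_inj.
move=> k t t' tt'; rewrite /g.
have bfy (y : n.-tuple (measurableTypeR R)) : bounded_measurable (fun x : measurableTypeR R => f [tuple of x :: y]).
  apply: (@bounded_measurable_comp _ _ _ _ (fun x => [tuple of x :: y]) f) => //.
  by apply: measurable_cons; [exact: measurable_id | exact: measurable_cst].
rewrite -RintegralB //; try exact: (bounded_integrable _ (bfy _)).
apply: Rintegral_bounded; first by apply: measurable_funB; exact: (bfy _).1.
move=> x; apply: (fc (lift ord0 k)) => i; case: (unliftP ord0 i) => [j|] -> //.
by rewrite !tnthS (inj_eq (@lift_inj _ _)) => /tt'.
Qed.

Lemma efron_stein n (phi : 'I_n -> K)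
    (f : n.-tuple (measurableTypeR R) -> R) c :
  injective phi -> bounded_measurable f ->
  (forall k (t t' : n.-tuple (measurableTypeR R)),
     (forall i, i != k -> tnth t i = tnth t' i) -> `|f t - f t'| <= c) ->
  \int[P]_w ((f (sample X phi w) - \int[P]_w' f (sample X phi w')) ^+ 2) <= n%:R * c ^+ 2.
Proof.
move=> phiI bf fc; have := sample_second_moment_le phiI bf fc.
rewrite (Rintegral_sqr_center _ _ (bounded_measurable_comp (measurable_sample X phi) bf)) /=.
lra.
Qed.

End SampleExpectation.

Lemma Rintegral_sample_stationary (R : realType) (disp : measure_display)
    (Omega : measurableType disp) (P : probability Omega R) (K : choiceType)
    (X : K -> {RV P >-> measurableTypeR R}) mu n (phi psi : 'I_n -> K)
    (f : n.-tuple (measurableTypeR R) -> R) :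
  iid_with_law X mu -> injective phi -> injective psi -> bounded_measurable f ->
  \int[P]_w f (sample X phi w) = \int[P]_w f (sample X psi w).
Proof.
move=> iid phiI psiI bf.
have E (chi : 'I_n -> K) : \int[P]_w f (sample X chi w) =
    \int[distribution P (sample X chi)]_t f t.
  rewrite /Rintegral integral_distribution //.
    by apply/measurable_EFinP; exact: bf.1.
  exact: (bounded_integrable P (bounded_measurable_comp (measurable_sample _ _) bf)).
rewrite !E /Rintegral; congr fine; apply: eq_measure_integral => A mA _.
exact: (sample_stationary iid).
Qed.

(** * Mean and variance of the count in a box *)

Lemma distr_natr_le (R : realDomainType) (a b c : nat) :
  (a <= b + c)%N -> (b <= a + c)%N -> `|a%:R - b%:R| <= c%:R :> R.
Proof.
rewrite -!(ler_nat R) !natrD ler_norml => h1 h2.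
by apply/andP; split; lra.
Qed.

Section BoxExpectation.
Context {R : realType} {d : nat} {disp : measure_display} {Omega : measurableType disp}.
Context (P : probability Omega R).
Variables (omega : site d -> {RV P >-> measurableTypeR R})
  (mu : set (measurableTypeR R) -> \bar R).
Hypothesis iid : iid_with_law omega mu.

Definition box_pos L (i : 'I_#|{: box d L}|) : site d := box_site (enum_val i).

Lemma box_pos_inj L m : injective (fun i => @box_pos L i + m).
Proof. by move=> i j /addIr/box_site_inj/enum_val_inj. Qed.

Definition hop L (i j : 'I_#|{: box d L}|) : R :=
  (dist1 (box_pos i) (box_pos j) == 1%N)%:R.

Lemma hop_sym L i j : @hop L i j = hop j i.
Proof. by rewrite /hop dist1C. Qed.

(** Displays the count as one deterministic function of the sampled potential, the same for every
    translate, so that the results on samples give measurability, variance and stationarity. *)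
Lemma box_cnt_translate (v : site d -> R) m L x :
  box_cnt (fun n => v (n + m)) L x = tcnt (@hop L) x [tuple v (box_pos i + m) | i < _].
Proof.
rewrite /box_cnt -(cnt_reindex _ (ham_sym _ _) (@enum_val_bij {: box d L})).
apply: eq_cnt => i j.
rewrite /ham anderson_std_basis /hop dist1C /box_pos; congr (_ + _).
rewrite (inj_eq (@box_site_inj _ _)) (inj_eq enum_val_inj) tnth_mktuple.
by case: eqP; rewrite ?mulr1 ?mulr0.
Qed.

Definition box_rv m L x w : R := (box_cnt (fun n => potential omega w (n + m)) L x)%:R.

Lemma box_rvE m L x w :
  box_rv m L x w = (tcnt (@hop L) x (sample omega (fun i => box_pos i + m) w))%:R.
Proof. by rewrite /box_rv box_cnt_translate. Qed.

Lemma box_cntE (v : site d -> R) L x : box_cnt v L x = box_cnt (fun n => v (n + 0)) L x.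
Proof.
have e : (fun n => v (n + 0)) = v by apply/funext => n; rewrite addr0.
by rewrite e.
Qed.

Lemma bounded_measurable_tcnt L x :
  bounded_measurable (fun t : #|{: box d L}|.-tuple (measurableTypeR R) => (tcnt (@hop L) x t)%:R : R).
Proof.
split; first exact: (measurable_tcnt (@hop_sym L)).
exists (#|{: box d L}|%:R) => t; rewrite ger0_norm ?ler0n // ler_nat.
exact: tcnt_le (@hop_sym L) _ _.
Qed.

Lemma bounded_measurable_box_rv m L x : bounded_measurable (box_rv m L x).
Proof.
have -> : box_rv m L x = (fun t => (tcnt (@hop L) x t)%:R) \o sample omega (fun i => box_pos i + m).
  by apply/funext => w; rewrite box_rvE.
exact: (bounded_measurable_comp (measurable_sample _ _) (bounded_measurable_tcnt L x)).
Qed.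

Lemma box_rv_le m L x w : box_rv m L x w <= (L.*2.+1)%:R ^+ d.
Proof.
by rewrite box_rvE -natrX -card_box ler_nat; exact: tcnt_le (@hop_sym L) _ _.
Qed.

Definition box_mean L x := \int[P]_w box_rv 0 L x w.

Lemma box_mean_translate m L x : \int[P]_w box_rv m L x w = box_mean L x.
Proof.
rewrite /box_mean; under eq_Rintegral do rewrite box_rvE.
under [RHS]eq_Rintegral do rewrite box_rvE.
exact: (Rintegral_sample_stationary iid (@box_pos_inj L _) (@box_pos_inj L _)
  (bounded_measurable_tcnt L x)).
Qed.

Lemma box_variance_le L x :
  \int[P]_w ((box_rv 0 L x w - box_mean L x) ^+ 2) <= (L.*2.+1)%:R ^+ d.
Proof.
have := @efron_stein _ _ _ P _ omega iid.1 _ _ _ 1 (@box_pos_inj L 0)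
  (bounded_measurable_tcnt L x).
rewrite expr1n mulr1 -natrX -card_box => h.
apply: le_trans (h _); last first.
  move=> k t t' tt'; have tt'' i : i != k -> tnth t' i = tnth t i by move=> /tt' ->.
  have h1 := tcnt_site (@hop_sym L) x tt'; have h2 := tcnt_site (@hop_sym L) x tt''.
  exact: distr_natr_le h1 h2.
rewrite le_eqVlt; apply/orP; left; apply/eqP; congr (Rintegral _ _ _).
apply/funext => w; rewrite box_rvE; congr ((_ - _) ^+ 2).
by rewrite /box_mean; under eq_Rintegral do rewrite box_rvE.
Qed.

Lemma box_rv_sum (s : seq (site d)) L x :
  bounded_measurable (fun w => \sum_(m <- s) box_rv m L x w) /\
  \int[P]_w (\sum_(m <- s) box_rv m L x w) = (size s)%:R * box_mean L x.
Proof.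
elim: s => [|m s [bS ES]].
  under eq_fun do rewrite big_nil.
  by rewrite Rintegral_prob_cst mul0r; split=> //; exact: bounded_measurable_cst.
under eq_fun do rewrite big_cons.
have bm := bounded_measurable_box_rv m L x.
split; first exact: bounded_measurableD.
rewrite RintegralD //; try exact: bounded_integrable.
by rewrite ES box_mean_translate /= -natr1 mulrDl mul1r addrC.
Qed.

Lemma box_mean_blocks j L x :
  `|box_mean (j * L.*2.+1 + L) x - (j.*2.+1)%:R ^+ d * box_mean L x|
    <= (block_error (d := d) j L)%:R.
Proof.
pose M := (j * L.*2.+1 + L)%N.
pose S w := \sum_(q : box d j) box_rv (block_shift L q) L x w.
have [bS ES] : bounded_measurable S /\ \int[P]_w S w = (j.*2.+1)%:R ^+ d * box_mean L x.
  have := box_rv_sum [seq block_shift L q | q <- enum {: box d j}] L x.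
  rewrite size_map -cardT card_box natrX.
  by under eq_fun do rewrite big_map big_enum.
rewrite -ES /box_mean -RintegralB //; try exact: bounded_integrable;
  try (apply: bounded_integrable; exact: bounded_measurable_box_rv).
apply: Rintegral_bounded.
  by apply: measurable_funB; [exact: (bounded_measurable_box_rv _ _ _).1|exact: bS.1].
move=> w; have [h1 h2] := cnt_blocks j L (potential omega w) x.
have SE : S w = (\sum_(q : box d j) box_cnt (fun n => potential omega w (n + block_shift L q)%R) L x)%N%:R.
  by rewrite natr_sum.
have rE : box_rv 0 M x w = (box_cnt (potential omega w) M x)%:R by rewrite /box_rv -box_cntE.
rewrite -/M rE SE; exact: distr_natr_le h1 h2.
Qed.

Lemma box_mean_cvg N x : is_ids omega N ->
  box_mean L x / (L.*2.+1)%:R ^+ d @[L --> \oo] --> N x.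
Proof.
move=> /(_ x) ids.
pose f L w : R := (L.*2.+1)%:R ^- d * box_rv 0 L x w.
have bf L : bounded_measurable (f L).
  by apply: bounded_measurableM; [exact: bounded_measurable_cst | exact: bounded_measurable_box_rv].
have f01 L w : `|f L w| <= 1.
  rewrite /f ger0_norm ?mulr_ge0 ?invr_ge0 ?exprn_ge0 ?ler0n //.
  by rewrite mulrC ler_pdivrMr ?exprn_gt0 ?ltr0n // mul1r box_rv_le.
have [||||| _ _] := @dominated_convergence _ _ _ P setT measurableT
  (fun L w => (f L w)%:E) (fun=> (N x)%:E) (fun=> 1%:E).
- by move=> L; apply/measurable_EFinP; exact: (bf L).1.
- exact: measurable_cst.
- apply: filterS ids => w Nw _; apply: cvg_EFin; first by near=> n.
  apply: cvg_trans Nw; apply: near_eq_cvg; near=> L.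
  by rewrite /f /= mulrC eig_count_box_cnt /box_rv -box_cntE.
- exact: (bounded_integrable P (bounded_measurable_cst 1)).
- by apply: aeW => w n _; rewrite /= lee_fin f01.
rewrite (_ : \int[P]_w (N x)%:E = (N x)%:E)%E => [/fine_cvg|].
  apply: cvg_trans; apply: near_eq_cvg; near=> L.
  rewrite /= -/(Rintegral P setT (f L)) /f RintegralZl //; first by rewrite mulrC.
  by apply: bounded_integrable; exact: bounded_measurable_box_rv.
by rewrite integral_cst //= probability_setT mule1.
Unshelve. all: by end_near.
Qed.

(** In [box_mean_blocks] L is kept fixed and both sides are divided by (2j+1)^d: the right side
    becomes the bound stated here, and the mean in the large box tends to the N(x) term as j
    grows. *)
Lemma box_mean_ids N L x : is_ids omega N ->
  `|box_mean L x - (L.*2.+1)%:R ^+ d * N x| <= d%:R * 2 * (L.*2.+1)%:R ^+ d.-1.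
Proof.
move=> ids; apply/ler_addgt0Pr => e e0.
set l : R := (L.*2.+1)%:R; have l0 : 0 < l ^+ d by rewrite exprn_gt0 ?ltr0n.
have := box_mean_cvg (x := x) ids => /cvgrPdist_lt/(_ (e / l ^+ d)).
rewrite divr_gt0 // => /(_ isT)[j _ jN].
(* The convergence threshold also serves as the block parameter, since the large box has half-side
   at least j. *)
have jM : (j <= j * L.*2.+1 + L)%N by nia.
have := jN _ jM; have := box_mean_blocks j L x.
rewrite /block_error natrM natrX natrM natrX natrM -/l.
rewrite (_ : (j * L.*2.+1 + L).*2.+1%:R = j.*2.+1%:R * l :> R); last first.
  by rewrite -natrM; congr _%:R; nia.
rewrite exprMn; set k : R := j.*2.+1%:R ^+ d; have k0 : 0 < k by rewrite exprn_gt0 ?ltr0n.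
move: (box_mean (_ + L) x) (box_mean L x) (N x) (d%:R * 2 * l ^+ d.-1) => M m n c.
move=> h0; have h1 : `|k^-1 * M - m| <= c.
  by rewrite -(ler_pM2l k0) -{1}(gtr0_norm k0) -normrM mulrBr mulVKf ?gt_eqF //.
rewrite -(ltr_pM2l l0) -{1}(gtr0_norm l0) -normrM => h2.
have -> : m - l ^+ d * n = - (k^-1 * M - m) - (l ^+ d * (n - M / (k * l ^+ d))).
  by field; rewrite !gt_eqF.
apply: le_trans (ler_normB _ _) _; rewrite normrN lerD //.
by apply: ltW; apply: lt_le_trans h2 _; rewrite mulrC divfK ?gt_eqF.
Qed.

End BoxExpectation.

(** By monotone convergence the series of the [g n] has finite expectation, hence is finite almost
    surely, and its terms vanish. This takes the place of Chebyshev with Borel-Cantelli. *)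
Lemma ae_cvg0_summable (R : realType) (disp : measure_display)
    (T : measurableType disp) (P : probability T R) (g : nat -> T -> R) (C : R) :
  (forall n, bounded_measurable (g n)) -> (forall n w, 0 <= g n w) ->
  (forall n, \sum_(0 <= k < n) \int[P]_w g k w <= C) ->
  {ae P, forall w, g n w @[n --> \oo] --> 0}.
Proof.
move=> bg g0 gC.
pose G w := (\sum_(0 <= n <oo) (g n w)%:E)%E.
have mg n : measurable_fun setT (fun w => (g n w)%:E).
  by apply/measurable_EFinP; exact: (bg n).1.
have G0 w : (0 <= G w)%E by apply: nneseries_ge0 => n _ _; rewrite lee_fin.
have intG : (\int[P]_w G w <= C%:E)%E.
  rewrite integral_nneseries //; last by move=> n w _; rewrite lee_fin.
  apply: lime_le.
    by apply: is_cvg_nneseries => n _ _; apply: integral_ge0 => w _; rewrite lee_fin.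
  apply: nearW => n; rewrite (_ : (\sum_(0 <= k < n) _)%E = (\sum_(0 <= k < n) \int[P]_w g k w)%:E).
    by rewrite lee_fin.
  rewrite -sumEFin; apply: eq_bigr => k _; rewrite /Rintegral fineK //.
  by apply: integrable_fin_num => //; exact: bounded_integrable.
have iG : P.-integrable setT G.
  apply/integrableP; split.
    by apply: ge0_emeasurable_sum => // n w _; rewrite lee_fin.
  under eq_integral do rewrite gee0_abs //.
  exact: le_lt_trans intG (ltry _).
apply: filterS (integrable_ae measurableT iG) => w /(_ Logic.I) Gw.
have gw0 k : true -> (0 <= (g k w)%:E)%E by rewrite lee_fin.
have Gfin : (\sum_(0 <= k <oo) (g k w)%:E < +oo)%E.
  by rewrite -/(G w) ltey_eq Gw.
have tail := nneseries_tail_cvg Gfin gw0.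
(* Each term is at most the tail of the series that starts with it. *)
have : (fun n => (g n w)%:E) n @[n --> \oo] --> 0%E.
  apply: (squeeze_cvge _ (cvg_cst _) tail); apply: nearW => n.
  rewrite lee_fin g0 /=.
  have := @nneseries_lim_ge _ (fun k => (g k w)%:E) xpredT n n.+1.
  by rewrite big_nat1; apply => k _ _; rewrite lee_fin.
by move/fine_cvg.
Qed.

(** * Negative powers of the side length *)

Section PowerSeries.
Context {R : realType}.
Local Notation l L := ((L.*2.+1)%:R : R).

(** Telescoping majorant. With p, q, r the square roots of L+1, L+2, 2L+1, the difference of
    inverses is 1/(pq(p+q)), and pq(p+q) <= 2 q^3 <= 2 (3/2)^3 r^3 = (27/4) r^3, which explains the
    constant 7. *)
Lemma powR_neg32_le L : l L `^ (- (3 / 2)) <=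
  7 * ((Num.sqrt L.+1%:R)^-1 - (Num.sqrt L.+2%:R)^-1).
Proof.
have -> : l L `^ (- (3 / 2)) = (Num.sqrt (l L) ^+ 3)^-1.
  rewrite powRN (mulrC 3) powRrM powR12_sqrt ?ler0n //.
  by rewrite -(powR_mulrn 3) ?sqrtr_ge0.
have p0 : 0 < Num.sqrt L.+1%:R :> R by rewrite sqrtr_gt0 ltr0n.
have q0 : 0 < Num.sqrt L.+2%:R :> R by rewrite sqrtr_gt0 ltr0n.
have r0 : 0 < Num.sqrt (l L) by rewrite sqrtr_gt0 ltr0n.
have p2 : Num.sqrt L.+1%:R ^+ 2 = L%:R + 1 :> R by rewrite sqr_sqrtr ?ler0n // natr1.
have q2 : Num.sqrt L.+2%:R ^+ 2 = L%:R + 2 :> R.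
  by rewrite sqr_sqrtr ?ler0n // -addn2 natrD.
have r2 : Num.sqrt (l L) ^+ 2 = 2 * L%:R + 1.
  by rewrite sqr_sqrtr ?ler0n // -addn1 natrD -muln2 natrM mulrC.
have L0 : 0 <= L%:R :> R by [].
move: p0 q0 r0 p2 q2 r2 L0.
move: (Num.sqrt L.+1%:R) (Num.sqrt L.+2%:R) (Num.sqrt (l L)) (L%:R : R) => p q r x.
move=> p0 q0 r0 p2 q2 r2 x0.
have pq : p <= q by rewrite -(ler_pXn2r (n := 2)) ?nnegrE ?ltW // p2 q2; lra.
have qr : q <= 3 / 2 * r.
  by rewrite -(ler_pXn2r (n := 2)) ?nnegrE ?mulr_ge0 ?ltW // exprMn q2 r2; lra.
have -> : p^-1 - q^-1 = (p * q * (p + q))^-1.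
  have e : (q - p) * (p + q) = 1 by transitivity (q ^+ 2 - p ^+ 2); [ring | rewrite p2 q2; ring].
  have pq0 : p + q != 0 by rewrite gt_eqF ?addr_gt0.
  have e' : q - p = (p + q)^-1 by apply: (mulIf pq0); rewrite e mulVf.
  by rewrite invfM -e'; field; rewrite !gt_eqF.
have r32 : 0 <= 3 / 2 * r by lra.
have h : p * q * (p + q) <= 7 * r ^+ 3.
  have q3 : q ^+ 3 <= (3 / 2 * r) ^+ 3 by rewrite lerXn2r ?nnegrE // ltW.
  have h1 : p * q * (p + q) <= q * q * (q + q).
    have p1 := ltW p0; have q1 := ltW q0.
    apply: ler_pM; rewrite ?mulr_ge0 ?addr_ge0 ?lerD //.
    by rewrite ler_wpM2r.
  apply: (le_trans h1); rewrite (_ : q * q * (q + q) = 2 * q ^+ 3); last by ring.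
  rewrite exprMn in q3; have : 0 <= r ^+ 3 by rewrite exprn_ge0 ?ltW.
  move: (r ^+ 3) (q ^+ 3) q3 => u v; lra.
have pq0 : 0 < p * q * (p + q) by rewrite !mulr_gt0 ?addr_gt0.
by rewrite ler_pdivlMr // mulrC ler_pdivrMr ?exprn_gt0.
Qed.

Lemma sum_powR_neg32_le n : \sum_(0 <= L < n) l L `^ (- (3 / 2)) <= 7.
Proof.
suff h : \sum_(0 <= L < n) l L `^ (- (3 / 2)) <= 7 * (1 - (Num.sqrt n.+1%:R)^-1).
  have : 0 <= (Num.sqrt n.+1%:R)^-1 :> R by rewrite invr_ge0 sqrtr_ge0.
  by move: h; set u := \sum_(0 <= L < n) _; set v := _^-1; lra.
elim: n => [|n IH]; first by rewrite big_geq // sqrtr1 invr1 subrr mulr0.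
rewrite big_nat_recr //=; apply: le_trans (lerD IH (powR_neg32_le n)) _.
by rewrite -mulrDr addrA subrK.
Qed.

Lemma cvg_powR_neg c : 0 < c -> l L `^ (- c) @[L --> \oo] --> 0.
Proof.
move=> c0; have [+ _] := cvg_at_rightP (fun a : R => a `^ c) 0 0.
move=> /(_ (powR_cvg0 c0) (fun L => (l L)^-1)) h.
rewrite (_ : (fun L => _) = (fun L => (l L)^-1 `^ c)); last first.
  by apply/funext => L; rewrite -[in RHS]powR_inv1 ?ler0n // -powRrM mulN1r.
apply: h; split; first by move=> n; rewrite invr_gt0 ltr0n.
apply: (squeeze_cvgr _ (cvg_cst 0) cvg_harmonic); apply: nearW => L.
rewrite invr_ge0 ler0n /= lef_pV2 ?posrE ?ltr0n // ler_nat ltnS.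
by rewrite -addnn leq_addr.
Qed.

End PowerSeries.

(** * Increments of the integrated density of states *)

Section Increments.
Context {R : realType} (nu : {measure set (measurableTypeR R) -> \bar R}) (N rho : R -> R).
Hypotheses (nuN : forall x, nu [set y | y <= x] = (N x)%:E)
  (rhoC : continuous rho) (rho0 : forall x, 0 <= rho x)
  (nurho : forall B, measurable B ->
     nu B = (\int[lebesgue_measure]_(x in B) (rho x)%:E)%E).

Lemma ids_increment x y m M : x <= y -> 0 <= m ->
  (forall t, x < t <= y -> m <= rho t <= M) ->
  m * (y - x) <= N y - N x <= M * (y - x).
Proof.
move=> xy m0 mM.
have mI : measurable (`]x, y]%classic : set (measurableTypeR R)) by exact: measurable_itv.
have M0 : x < y -> 0 <= M.
  move=> xy'; have := mM y; rewrite xy' lexx => /(_ isT)/andP[h1 h2].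
  exact: le_trans m0 (le_trans h1 h2).
have nuI : nu `]x, y]%classic = (N y - N x)%:E.
  have mx : measurable ([set t | t <= x] : set (measurableTypeR R)).
    rewrite (_ : [set t | t <= x] = `]-oo, x]%classic); first exact: measurable_itv.
    by apply/seteqP; split=> t /=; rewrite in_itv.
  have := nuN y; rewrite (_ : [set t | t <= y] = [set t | t <= x] `|` `]x, y]%classic); last first.
    apply/seteqP; split=> t /=; rewrite in_itv /=.
      by move=> ty; have [tx|tx] := leP t x; [left|right].
    by move=> [tx|/andP[]//]; exact: le_trans tx xy.
  rewrite measureU //; last first.
    by apply/seteqP; split=> t //= [tx]; rewrite in_itv /= ltNge tx.
  move=> e; have : ((N x)%:E + nu `]x, y]%classic)%E = (N y)%:E.
    by apply: etrans _ e; congr (_ + _)%E; exact: esym (nuN x).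
  by case: (nu _) => [r| |] //= -[<-]; rewrite addrAC subrr add0r.
have leb : lebesgue_measure `]x, y]%classic = (y - x)%:E.
  by rewrite lebesgue_measure_itv /= lte_fin; case: ltP => // yx; rewrite (le_anti (introT andP (conj xy yx))) subrr.
have mrho : measurable_fun `]x, y]%classic (fun t => (rho t)%:E).
  apply/measurable_EFinP; apply: (@measurable_funTS _ _ _ _ `]x, y]%classic).
  exact: continuous_measurable_fun.
rewrite -!lee_fin -nuI nurho //; apply/andP; split.
  rewrite EFinM -leb -integral_cst //.
  apply: ge0_le_integral => //; try exact: measurable_cst;
    by move=> t /=; rewrite in_itv /= lee_fin => /mM/andP[].
(* When x = y the bounds on [rho] are vacuous and [M] may be negative, so this case is treated
   apart. *)
have [xy'|yx] := ltP x y; last first.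
  have e : y = x by apply: le_anti; rewrite xy yx.
  by rewrite e set_itvoc0 integral_set0 subrr mulr0.
rewrite EFinM -leb -integral_cst //.
apply: ge0_le_integral => //; try exact: measurable_cst;
  by move=> t /=; rewrite in_itv /= lee_fin => /mM/andP[].
Qed.

(** [s L] is the inverse length scale of the window and [c] its rescaled limiting length; both
    endpoints approach [E], where [rho] is nearly constant. *)
Lemma cvg_increment E c (x y s : nat -> R) : 0 < rho E ->
  (forall L, 0 <= s L) -> (forall L, x L <= y L) ->
  x L @[L --> \oo] --> E -> y L @[L --> \oo] --> E ->
  s L * (y L - x L) @[L --> \oo] --> c ->
  s L * (N (y L) - N (x L)) @[L --> \oo] --> rho E * c.
Proof.
move=> rE s0 xy xE yE sc.
pose u L := s L * (y L - x L).
have uC : forall e, 0 < e -> \forall L \near \oo,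
    `|s L * (N (y L) - N (x L)) - rho E * u L| <= e * u L.
  (* The cap at [rho E] keeps the lower density bound [rho E - e'] nonnegative, as [ids_increment]
     requires. *)
  move=> e e0; pose e' := Num.min e (rho E).
  have e'0 : 0 < e' by rewrite lt_min e0.
  have /cvgrPdist_le/(_ _ e'0)[dl /= dl0 hdl] := @rhoC E.
  have /cvgrPdist_lt/(_ _ dl0) Hx := xE.
  have /cvgrPdist_lt/(_ _ dl0) Hy := yE.
  near=> L.
  have hx : `|E - x L| < dl by near: L.
  have hy : `|E - y L| < dl by near: L.
  have /andP[h1 h2] : (rho E - e') * (y L - x L) <= N (y L) - N (x L) <=
      (rho E + e') * (y L - x L).
    apply: ids_increment => //; first by rewrite subr_ge0 ge_min lexx orbT.
    move=> t /andP[xt ty]; have : `|rho E - rho t| <= e'.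
      apply: hdl; rewrite /ball /=.
      move: hx hy; rewrite !ltr_norml => /andP[x1 x2] /andP[y1 y2].
      by apply/andP; split; lra.
    by rewrite ler_norml => /andP[r1 r2]; apply/andP; split; lra.
  have ee : e' <= e by rewrite ge_min lexx.
  have d0 : 0 <= y L - x L by rewrite subr_ge0.
  rewrite /u mulrCA -mulrBr normrM (ger0_norm (s0 L)) mulrCA ler_wpM2l //.
  rewrite ler_norml; apply/andP; split; nra.
have du : s L * (N (y L) - N (x L)) - rho E * u L @[L --> \oo] --> 0.
  apply/cvgr0Pnorm_le => eta eta0.
  (* [|c| + 1] eventually bounds the rescaled length [u L]. *)
  have k0 : 0 < `|c| + 1 by rewrite ltr_wpDl.
  have /cvgrPdist_lt/(_ _ ltr01) H2 := sc.
  have H1 := uC _ (divr_gt0 eta0 k0).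
  near=> L.
  have h1 : `|s L * (N (y L) - N (x L)) - rho E * u L| <= eta / (`|c| + 1) * u L by near: L.
  have h2 : `|c - u L| < 1 by near: L.
  apply: (le_trans h1); rewrite -[leRHS](divfK (lt0r_neq0 k0)).
  rewrite ler_wpM2l ?divr_ge0 ?ltW //.
  have := ler_norm c; move: h2; rewrite ltr_norml => /andP[]; lra.
rewrite -[X in _ --> X]add0r.
rewrite (_ : (fun L => _) =
  fun L => (s L * (N (y L) - N (x L)) - rho E * u L) + rho E * u L); last first.
  by apply/funext => L; rewrite subrK.
by apply: cvgD du _; apply: cvgM sc; exact: cvg_cst.
Unshelve. all: by end_near.
Qed.

End Increments.

(** * Almost sure fluctuations of the count *)

Section Fluctuation.
Context {R : realType} {d : nat} {disp : measure_display} {Omega : measurableType disp}.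
Context (P : probability Omega R).
Variables (omega : site d -> {RV P >-> measurableTypeR R})
  (mu : set (measurableTypeR R) -> \bar R) (gamma : R).
Hypotheses (iid : iid_with_law omega mu) (d2 : (2 <= d)%N)
  (gd : gamma < (d%:R - 1) / (2 * d%:R)).
Local Notation l L := ((L.*2.+1)%:R : R).

(** The first exponent is that of the normalised variance: 2 gamma < 1 - 1/d gives d - 2 gamma > d -
    1 + 1/d, whose minimum over d >= 2 is 3/2, at d = 2. The second bound controls the surface error
    and the shift of the left endpoint. *)
Lemma gamma_bounds : d%:R - 2 * (d%:R - gamma) <= - (3 / 2) /\ gamma < 1.
Proof.
have x2 : 2 <= d%:R :> R by rewrite (ler_nat R 2 d).
move: gd; move: (d%:R : R) x2 => x x2; rewrite ltr_pdivlMr; last lra.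
by move=> h; split; nra.
Qed.

Lemma side_gt0 L : 0 < l L. Proof. by rewrite ltr0n. Qed.

(** The error splits into a centred part, whose normalised squares have summable expectations, and a
    deterministic surface part. The null set may depend on the sequence [x], which is harmless since
    only three sequences are used. *)
Lemma box_rv_fluctuation N (x : nat -> R) : is_ids omega N ->
  {ae P, forall w, (box_rv omega 0 L (x L) w - l L ^+ d * N (x L)) / l L `^ (d%:R - gamma)
    @[L --> \oo] --> 0}.
Proof.
move=> ids; have [g32 g1] := gamma_bounds.
pose D L := l L `^ (d%:R - gamma).
have D0 L : 0 < D L by rewrite powR_gt0 // side_gt0.
have lD L e : l L `^ e / D L = l L `^ (e - (d%:R - gamma)).
  by rewrite -powRN -powRD //; apply/implyP => _; rewrite gt_eqF // side_gt0.
have ld L : l L ^+ d = l L `^ d%:R by rewrite powR_mulrn // ltW ?side_gt0.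
pose g L w := ((box_rv omega 0 L (x L) w - box_mean omega L (x L)) / D L) ^+ 2.
have bc L : bounded_measurable (fun w => box_rv omega 0 L (x L) w - box_mean omega L (x L)).
  by apply: bounded_measurableD; [exact: bounded_measurable_box_rv|exact: bounded_measurable_cst].
have bg L : bounded_measurable (g L).
  by apply: bounded_measurableM; apply: bounded_measurableM => //; exact: bounded_measurable_cst.
have gle L : \int[P]_w g L w <= l L `^ (- (3 / 2)).
  have -> : \int[P]_w g L w = (D L)^-1 ^+ 2 *
      \int[P]_w ((box_rv omega 0 L (x L) w - box_mean omega L (x L)) ^+ 2).
    rewrite -RintegralZl //; last exact: (bounded_integrable P (bounded_measurableM (bc L) (bc L))).
    by apply: eq_Rintegral => w _; rewrite /g exprMn mulrC.
  apply: (le_trans (y := (D L)^-1 ^+ 2 * l L ^+ d)).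
    by rewrite ler_wpM2l ?sqr_ge0 // (box_variance_le iid).
  rewrite ld expr2 mulrC mulrA !lD ler_powR //; first by rewrite ler1n.
  by apply: le_trans g32; lra.
have gae : {ae P, forall w, g L w @[L --> \oo] --> 0}.
  apply: (@ae_cvg0_summable _ _ _ _ g 7) => //.
    by move=> L w; rewrite sqr_ge0.
  by move=> n; apply: le_trans (sum_powR_neg32_le n); apply: ler_sum => L _; exact: gle.
(* The surface order d-1 minus the normalising order d - gamma is -(1 - gamma). *)
have mcvg : (box_mean omega L (x L) - l L ^+ d * N (x L)) / D L @[L --> \oo] --> 0.
  apply/norm_cvg0P; apply: (squeeze_cvgr (f := fun=> 0)
    (h := fun L => d%:R * 2 * l L `^ (- (1 - gamma)))).
  - apply: nearW => L; rewrite normr_ge0 normrM normfV (gtr0_norm (D0 L)) /=.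
    rewrite ler_pdivrMr //; apply: le_trans (box_mean_ids iid L (x L) ids) _.
    rewrite -[leRHS]mulrA; apply: ler_wpM2l; first by rewrite mulr_ge0 ?ler0n.
    rewrite -ler_pdivrMr // -(powR_mulrn _ (ltW (side_gt0 L))) lD.
    rewrite -subn1 natrB; last exact: ltnW.
    by rewrite ler_powR ?ler1n //; lra.
  - exact: cvg_cst.
  - rewrite -[X in _ --> X](mulr0 (d%:R * 2)); apply: cvgMr; apply: cvg_powR_neg; lra.
apply: filterS gae => w gw.
have c1 : (box_rv omega 0 L (x L) w - box_mean omega L (x L)) / D L @[L --> \oo] --> 0.
  apply/cvgr0Pnorm_lt => e e0.
  have /cvgr0Pnorm_lt/(_ _ (exprn_gt0 2 e0)) h := gw.
  near=> L; have : `|g L w| < e ^+ 2 by near: L.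
  by rewrite /g normrX ltr_pXn2r ?nnegrE ?normr_ge0 ?(ltW e0).
rewrite -[X in _ --> X]addr0.
rewrite (_ : (fun L => _) = fun L => (box_rv omega 0 L (x L) w - box_mean omega L (x L)) / D L +
  (box_mean omega L (x L) - l L ^+ d * N (x L)) / D L); last first.
  by apply/funext => L; rewrite -mulrDl addrA subrK.
exact: cvgD c1 mcvg.
Unshelve. all: by end_near.
Qed.

End Fluctuation.

(** Since the interval contains [a], the increment of the counting function from [a] is only a lower
    bound; starting from any [a'] below [a] gives an upper bound. *)
Lemma eig_count_itv (R : realType) (d : nat) (v : site d -> R) L (a' a b : R) :
  a' < a -> a <= b ->
  (box_cnt v L b <= box_cnt v L a + eig_count v L `[a, b])%N /\
  (eig_count v L `[a, b] + box_cnt v L a' <= box_cnt v L b)%N.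
Proof.
move=> aa ab; rewrite -!eig_count_box_cnt /eig_count.
elim: (eigenvalues _) => // y s [IH1 IH2] /=.
rewrite !in_itv /=; split.
  rewrite [leqRHS]addnACA; apply: leq_add => //.
  by case: (leP y b) => // yb; case: (leP y a) => // ay; rewrite (ltW ay).
rewrite [leqLHS]addnACA; apply: leq_add => //.
case: (leP y a') => [ya|_]; last by case: (a <= y)%R; case: (y <= b)%R.
have ya2 := le_lt_trans ya aa.
by rewrite leNgt ya2 /= (le_trans (ltW ya2) ab).
Qed.

Unset Implicit Arguments.
Set Strict Implicit.

Theorem corollary1p8 (R : realType) (d : nat) (lam : R)
    (mu1 mu2 : probability (measurableTypeR R) R)
    (disp : measure_display) (Omega : measurableType disp)
    (P : probability Omega R)
    (omega : site d -> {RV P >-> measurableTypeR R})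
    (rho : R -> R) (E gamma a b : R) :
  (2 <= d)%N -> 0 < lam -> is_cauchy lam mu1 ->
  iid_with_law omega (convolution mu1 mu2) ->
  is_dos_function omega rho -> 0 < rho E ->
  0 < gamma -> gamma < (d%:R - 1) / (2 * d%:R) -> a < b ->
  {ae P, forall w,
    (eig_count (potential omega w) L
       `[E + a / ((L.*2.+1)%:R `^ gamma), E + b / ((L.*2.+1)%:R `^ gamma)])%:R
    / ((b - a) * ((L.*2.+1)%:R `^ (d%:R - gamma)))
      @[L --> \oo] --> rho E}.
Proof.
move=> d2 lam0 _ iid [nu [N ids nuN] [rhoC rho0 nurho]] rE g0 gd ab.
have [g32 g1] := gamma_bounds d2 gd.
pose l L : R := (L.*2.+1)%:R; pose D L := l L `^ (d%:R - gamma).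
have l0 L : 0 < l L by rewrite ltr0n.
have D0 L : 0 < D L by rewrite powR_gt0.
pose s L := l L `^ gamma.
have s0 L : 0 < s L by rewrite powR_gt0.
have sV L : (s L)^-1 = l L `^ (- gamma) by rewrite powRN.
(* [x'] is the lowered left endpoint; multiplied by [s L], its shift becomes (2L+1)^-(1-gamma) and
   vanishes in the limit. *)
pose x L := E + a / s L; pose y L := E + b / s L; pose x' L := x L - (l L)^-1.
have xy L : x L <= y L by rewrite lerD2l ler_pM2r ?invr_gt0 // ltW.
have x'x L : x' L < x L by rewrite ltrBlDr ltrDl invr_gt0.
have sE : (s L)^-1 @[L --> \oo] --> 0.
  rewrite (_ : (fun L => _) = fun L => l L `^ (- gamma)); last exact/funext.
  exact: cvg_powR_neg.
have cE c : E + c / s L @[L --> \oo] --> E.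
  rewrite -[X in _ --> X]addr0 -[X in E + X](mulr0 c).
  by apply: cvgD; [exact: cvg_cst | apply: cvgM => //; exact: cvg_cst].
have xE : x L @[L --> \oo] --> E := cE a.
have yE : y L @[L --> \oo] --> E := cE b.
have lV : (l L)^-1 @[L --> \oo] --> 0.
  rewrite (_ : (fun L => _) = fun L => l L `^ (- 1)); last first.
    by apply/funext => L; rewrite powR_inv1 // ltW.
  exact: cvg_powR_neg.
have x'E : x' L @[L --> \oo] --> E.
  by rewrite -[X in _ --> X]subr0; exact: cvgB.
have sxy : s L * (y L - x L) @[L --> \oo] --> b - a.
  rewrite (_ : (fun L => _) = fun=> b - a); first exact: cvg_cst.
  by apply/funext => L; rewrite /x /y; field; rewrite gt_eqF.
have sx'y : s L * (y L - x' L) @[L --> \oo] --> b - a.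
  rewrite -[X in _ --> X]addr0.
  rewrite (_ : (fun L => _) = fun L => s L * (y L - x L) + l L `^ (- (1 - gamma))).
    by apply: cvgD => //; apply: cvg_powR_neg; rewrite subr_gt0.
  apply/funext => L; rewrite (_ : - (1 - gamma) = gamma + - 1); last by ring.
  rewrite powRD; last by apply/implyP => _; rewrite gt_eqF.
  by rewrite powR_inv1 ?(ltW (l0 L)) // /x' -/(s L); ring.
have inc := cvg_increment nuN rhoC rho0 nurho rE (fun L => ltW (s0 L)).
have Nxy := inc _ _ _ xy xE yE sxy.
have Nx'y := inc _ _ _ (fun L => ltW (lt_le_trans (x'x L) (xy L))) x'E yE sx'y.
have fx := box_rv_fluctuation iid d2 gd x ids.
have fx' := box_rv_fluctuation iid d2 gd x' ids.
have fy := box_rv_fluctuation iid d2 gd y ids.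
(* Volume over normalisation is exactly the inverse window scale, so the main term is the rescaled
   increment of [N] handled by [cvg_increment]. *)
have ldD L : l L ^+ d / D L = s L.
  rewrite -(powR_mulrn _ (ltW (l0 L))) -powRN -powRD; last first.
    by apply/implyP => _; rewrite gt_eqF.
  by rewrite /s; congr powR; ring.
apply: filterS3 fx fx' fy => w Fx Fx' Fy.
pose F L t : R := box_rv omega 0 L t w.
have cF (z : nat -> R) :
    (F L (z L) - l L ^+ d * N (z L)) / D L @[L --> \oo] --> 0 ->
    (F L (y L) - l L ^+ d * N (y L)) / D L @[L --> \oo] --> 0 ->
    s L * (N (y L) - N (z L)) @[L --> \oo] --> rho E * (b - a) ->
    (F L (y L) - F L (z L)) / D L @[L --> \oo] --> rho E * (b - a).
  move=> hz hy hN; rewrite -[X in _ --> X]addr0 -[X in _ + X](subr0 0).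
  rewrite (_ : (fun L => _) = fun L => s L * (N (y L) - N (z L)) +
    ((F L (y L) - l L ^+ d * N (y L)) / D L - (F L (z L) - l L ^+ d * N (z L)) / D L)).
    by apply: cvgD => //; exact: cvgB.
  by apply/funext => L; rewrite -ldD; ring.
have ba0 : b - a != 0 by rewrite gt_eqF // subr_gt0.
pose X L : R := (eig_count (potential omega w) L `[x L, y L])%:R.
have XD : X L / D L @[L --> \oo] --> rho E * (b - a).
  apply: (squeeze_cvgr _ (cF x Fx Fy Nxy) (cF x' Fx' Fy Nx'y)); apply: nearW => L.
  have [h1 h2] := eig_count_itv (potential omega w) L (x'x L) (xy L).
  rewrite !ler_pM2r ?invr_gt0 // lerBlDr lerBrDr /F /X /box_rv -!box_cntE.
  by rewrite -!natrD !ler_nat addnC h1.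
rewrite (_ : (fun L => _) = fun L => (b - a)^-1 * (X L / D L)).
  rewrite -[X in _ --> X](mulKf ba0) [X in _^-1 * X]mulrC.
  by apply: cvgM XD; exact: cvg_cst.
by apply/funext => L; rewrite invfM mulrCA.
Qed.
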